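(* For every lattice-face $d$-polytope $P\subset\mathbb R^d$ ($d\ge1$), $|\mathcal L(\Omega(P))|=\mathrm{Vol}(P)$.
   Context: For $k\ge1$, $\pi:\mathbb R^k\to\mathbb R^{k-1}$ forgets the last coordinate ($\mathbb R^0$ is a point). For a compact set $S\subset\mathbb R^k$ and $y\in\pi(S)$, let $n(y,S)$ be the point of $S\cap\pi^{-1}(y)$ with smallest last coordinate; the negative boundary is $NB(S)=\{n(y,S):y\in\pi(S)\}$ and the nonnegative part is $\Omega(S)=S\setminus NB(S)$. $\mathcal L(S)=S\cap\mathbb Z^k$. $\mathrm{Vol}$ is $d$-dimensional volume. Lattice-face polytopes are defined recursively: a segment in $\mathbb R$ is lattice-face if its endpoints are integers. For $d\ge2$, a $d$-polytope $P\subset\mathbb R^d$ with vertex set $V$ is lattice-face if for every $d$-element subset $U\subset V$: (a) $\pi(\mathrm{conv}(U))$ is a lattice-face polytope in $\mathbb R^{d-1}$, and (b) $\pi(H_U\cap\mathbb Z^d)=\mathbb Z^{d-1}$, where $H_U$ is the affine span of $U$. *)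

(* Defs.v *)
From HB Require Import structures.
From mathcomp Require Import all_boot all_order all_algebra.
From mathcomp Require Import all_classical all_reals.
From mathcomp Require Import ereal topology normedtype sequences measure
  lebesgue_measure lebesgue_integral.
Set Implicit Arguments. Unset Strict Implicit. Unset Printing Implicit Defensive.
Import Order.TTheory GRing.Theory Num.Theory.
Local Open Scope classical_set_scope.
Local Open Scope ring_scope.

Section LatticeFace.
Variable R : realType.

Definition proj {k : nat} (x : 'rV[R]_k.+1) : 'rV[R]_k :=
  \row_(i < k) x 0 (widen_ord (leqnSn k) i).

Definition lastc {k : nat} (x : 'rV[R]_k.+1) : R := x 0 ord_max.

Definition ext {k : nat} (y : 'rV[R]_k) (t : R) : 'rV[R]_k.+1 :=
  \row_(i < k.+1) (if unlift ord_max i is Some j then y 0 j else t).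

Definition isZ (a : R) : Prop := exists z : int, a = z%:~R.

Definition Zpts (k : nat) : set 'rV[R]_k := [set x | forall i, isZ (x 0 i)].

Definition Lat {k : nat} (S : set 'rV[R]_k) : set 'rV[R]_k := S `&` @Zpts k.

Definition conv {k : nat} (S : set 'rV[R]_k) : set 'rV[R]_k :=
  [set x | exists (pts : seq 'rV[R]_k) (w : seq R),
     [/\ size w = size pts, (forall p, p \in pts -> S p),
         (forall c, c \in w -> 0 <= c), \sum_(c <- w) c = 1 &
         x = \sum_(i < size pts) w`_i *: pts`_i]].

Definition aff {k : nat} (S : set 'rV[R]_k) : set 'rV[R]_k :=
  [set x | exists (pts : seq 'rV[R]_k) (w : seq R),
     [/\ size w = size pts, (forall p, p \in pts -> S p),
         \sum_(c <- w) c = 1 &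
         x = \sum_(i < size pts) w`_i *: pts`_i]].

Definition polytope {k : nat} (P : set 'rV[R]_k) : Prop :=
  exists V : seq 'rV[R]_k, P = conv [set` V].

Definition fulldim {k : nat} (P : set 'rV[R]_k) : Prop := aff P = setT.

Definition vertex {k : nat} (P : set 'rV[R]_k) (v : 'rV[R]_k) : Prop :=
  P v /\ forall x y t, P x -> P y -> 0 < t < 1 ->
    v = (1 - t) *: x + t *: y -> x = v /\ y = v.

Fixpoint latticeFace (k : nat) : set 'rV[R]_k -> Prop :=
  match k as k0 return set 'rV[R]_k0 -> Prop with
  | 0 => fun _ => False
  | S k' => fun P =>
      if k' is 0 then
        exists a b : R, [/\ isZ a, isZ b, a < b &
           P = [set x | a <= x 0 ord0 <= b]]
      else
        [/\ polytope P, fulldim P &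
          forall U : seq 'rV[R]_k'.+1,
            uniq U -> size U = k'.+1 -> (forall u, u \in U -> vertex P u) ->
            latticeFace (proj @` conv [set` U]) /\
            proj @` (aff [set` U] `&` @Zpts k'.+1) = @Zpts k']
  end.

Definition NB {k : nat} (S : set 'rV[R]_k.+1) : set 'rV[R]_k.+1 :=
  [set x | S x /\ forall x', S x' -> proj x' = proj x -> lastc x <= lastc x'].

Definition Omega {k : nat} (S : set 'rV[R]_k.+1) : set 'rV[R]_k.+1 :=
  S `\` NB S.

(* k-dimensional volume, via iterated Lebesgue integrals of slices
   (Cavalieri); vol on R^0 is the counting measure of the point. *)
Fixpoint vol (k : nat) : set 'rV[R]_k -> \bar R :=
  match k as k0 return set 'rV[R]_k0 -> \bar R with
  | 0 => fun S => if `[< S !=set0 >] then 1%E else 0%E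
  | S k' => fun S =>
      (\int[@lebesgue_measure R]_t vol [set y : 'rV[R]_k' | S (ext y t)])%E
  end.

End LatticeFace.

(* Main.v *)
From Pilot Require Import Defs.
From HB Require Import structures.
From mathcomp Require Import all_boot all_order all_fingroup all_algebra.
From mathcomp Require Import all_classical all_reals.
From mathcomp Require Import ereal topology normedtype sequences measure
  lebesgue_measure lebesgue_integral numfun measurable_realfun.
From mathcomp Require Import ring lra zify.
Import Order.TTheory GRing.Theory Num.Theory.
Local Open Scope classical_set_scope.
Local Open Scope ring_scope.

(* Two remarks reduce the theorem to a count in dilations of [P].  Facet hyperplanes take integral
   heights over lattice points, so a lattice point [z] lies in [Omega P] exactly when [z - e_d / 2]
   lies in [P], and such a half-shifted point is generic: it lies on no hyperplane spanned by
   vertices.  And if the number of half-shifted lattice points of every translated dilation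
   [N P + c] is [N ^ d * K], comparison with the cells of a fine grid gives [vol P = K].

   Lower faces of generically lifted vertices triangulate [P] without new vertices, so it suffices
   to count in a simplex [W] spanned by vertices, where the count is [N ^ d |det W| / d!].  The
   indicator of [W] is a signed sum, over its vertices [a], of indicators of cones at [a] flipped
   towards increasing first coordinate.  The slice of the cone at [a] by the lattice hyperplane
   [x_1 = t] is a [(t - a_1)]-fold dilation of the simplex of slopes [(b - a) / (b_1 - a_1)], of
   dimension one less and again integral.  By induction the count is a sum over [t] and [a] of
   truncated powers [(t - a_1)_+ ^ (d - 1)] over [prod_b (b_1 - a_1)], a divided difference of a
   power-sum polynomial, of which only the leading coefficient survives. *)

Set Implicit Arguments. Unset Strict Implicit. Unset Printing Implicit Defensive.

(** The induction on the dimension dictates what is counted. A slice of the cone at a vertex of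
    [N W + c] is dilated by [t - a_1] and translated by a multiple of the vertex, so arbitrary
    dilations and lattice translations must be carried along even where only [P] itself matters. The
    cones are unbounded and have no total count; they are therefore compared only inside a slice,
    where each is a bounded dilated simplex. The shift is any [s] with [0 < s < 1] rather than one
    half alone: since no such shift puts a lattice point on a spanned hyperplane, a point sliding
    from [z] down to [z - e_d] cannot leave its simplex on the way. This is what connects [Omega P]
    with the half-shifted points. No volume of a simplex is ever computed. The constant [K] is the
    count for [N = 1], [c = 0], and the same [K] is the volume because the count is exact for all
    large [N]. Monotonicity of [vol] and its values on unions of grid cells suffice for this, so
    measurability of the slices of [P] never arises. *)

Local Notation proj := (@Pilot.Defs.proj _ _).

(** * Divided differences and power sums *)

(** The sum is the divided difference of [f] at the nodes. [f] equals its Lagrange interpolant [g],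
    since [f - g] has [N + 1] roots and too small a degree; each [L a] is monic of degree [N], so
    comparing coefficients of degree [N] gives the value. *)
Lemma lagrange_lead_coef (F : fieldType) (N : nat) (tau : 'I_N.+1 -> F)
    (f : {poly F}) :
  injective tau -> (size f <= N.+1)%N ->
  \sum_a f.[tau a] / \prod_(b | b != a) (tau a - tau b) = f`_N.
Proof.
move=> inj_tau sz_f.
pose L (a : 'I_N.+1) : {poly F} := \prod_(b | b != a) ('X - (tau b)%:P).
have szL a : size (L a) = N.+1.
  rewrite size_prod => [|b _]; last by rewrite polyXsubC_eq0.
  under eq_bigr do rewrite size_XsubC.
  by rewrite sum_nat_const cardC1 card_ord /= muln2 -addnn subSn ?leq_addl ?addnK.
have lcL a : (L a)`_N = 1.
  have /monicP : L a \is monic by apply: monic_prod => b _; apply: monicXsubC.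
  by rewrite /lead_coef szL.
pose g : {poly F} := \sum_a (f.[tau a] / \prod_(b | b != a) (tau a - tau b)) *: L a.
have nz a : \prod_(b | b != a) (tau a - tau b) != 0.
  apply/prodf_neq0 => b nba; rewrite subr_eq0 (inj_eq inj_tau) eq_sym.
  exact: nba.
suff fg : f = g.
  rewrite [in RHS]fg coef_sum; apply: eq_bigr => a _.
  by rewrite coefZ lcL mulr1.
apply/eqP; rewrite -subr_eq0; apply/eqP.
apply: (@roots_geq_poly_eq0 _ _ (codom tau)).
- apply/allP => _ /codomP [a ->]; rewrite rootE hornerD hornerN subr_eq0.
  apply/eqP; rewrite horner_sum (bigD1 a) //= [X in _ + X]big1 ?addr0.
    rewrite hornerZ; have -> : (L a).[tau a] = \prod_(b | b != a) (tau a - tau b).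
      by rewrite horner_prod; apply: eq_bigr => b _; rewrite !hornerE.
    by rewrite divfK.
  move=> b nba; rewrite hornerZ horner_prod [X in _ * X](bigD1 a) /=; last by rewrite eq_sym.
  by rewrite hornerXsubC subrr mul0r mulr0.
- by rewrite map_inj_uniq ?enum_uniq.
- rewrite size_codom card_ord (leq_trans (size_polyD _ _)) // geq_max sz_f.
  rewrite size_polyN (leq_trans (size_sum _ _ _)) //.
  by apply/bigmax_leqP => a _; rewrite (leq_trans (size_scale_leq _ _)) ?szL.
Qed.

Lemma power_sum_poly (F : numFieldType) (d : nat) :
  exists Q : {poly F}, [/\ (size Q <= d.+2)%N, Q`_d.+1 = d.+1%:R^-1 &
    forall m, Q.[m%:R] = \sum_(j < m) j.+1%:R ^+ d].
Proof.
(* The backward difference is inverted on all polynomials at once, so that the induction can strip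
   leading terms: [D n.+1], the backward difference of ['X^(n.+1)], has leading coefficient
   [n + 1]. *)
suff H (p : {poly F}) n : (size p <= n)%N -> exists Q : {poly F},
    [/\ (size Q <= n.+1)%N, Q`_n = p`_n.-1 / n%:R, Q.[0] = 0 &
        forall m : nat, Q.[m.+1%:R] = Q.[m%:R] + p.[m.+1%:R]].
  have [|Q [szQ lQ Q0 QS]] := H 'X^d d.+1; first by rewrite size_polyXn.
  exists Q; split => //; first by rewrite lQ coefXn eqxx mul1r.
  elim=> [|m IHm]; first by rewrite big_ord0.
  by rewrite big_ord_recr /= -IHm QS hornerXn.
elim: n p => [p|n IH p szp].
  rewrite leqn0 size_poly_eq0 => /eqP ->; exists 0.
  by split=> [||| m]; rewrite ?size_poly0 ?coef0 ?horner0 ?mul0r ?addr0.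
have n1 : n.+1%:R != 0 :> F by rewrite pnatr_eq0.
pose D (i : nat) : {poly F} := 'X^i - ('X - 1) ^+ i.
have [szD lD] : (size (D n.+1) <= n.+1)%N /\ (D n.+1)`_n = n.+1%:R.
  elim: n {IH szp n1} => [|n [szD lD]].
    by rewrite /D !expr1 opprB addrC subrK size_poly1 coef1.
  have -> : D n.+2 = D n.+1 * 'X + ('X - 1) ^+ n.+1.
    by rewrite /D (exprS ('X - 1)) exprSr; ring.
  have szX : size (('X - 1) ^+ n.+1 : {poly F}) = n.+2.
    by rewrite -[1]/(1%:P) size_exp_XsubC.
  split.
    rewrite (leq_trans (size_polyD _ _)) // geq_max szX leqnn andbT.
    by rewrite (leq_trans (size_polyMleq _ _)) // size_polyX addn2.
  rewrite coefD coefMX /= lD.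
  have /monicP : (('X - 1) ^+ n.+1 : {poly F}) \is monic.
    by rewrite monic_exp // -[1]/(1%:P) monicXsubC.
  by rewrite /lead_coef szX /= => ->; rewrite natr1.
pose k := p`_n / n.+1%:R.
have [|Q [szQ _ Q0 QS]] := IH (p - k *: D n.+1).
  have sz1 : (size (p - k *: D n.+1)%R <= n.+1)%N.
    rewrite (leq_trans (size_polyD _ _)) // geq_max szp size_polyN.
    by rewrite (leq_trans (size_scale_leq _ _)).
  apply/leq_sizeP => j; rewrite leq_eqVlt => /predU1P[<-|nj]; last first.
    by apply: (leq_sizeP _ _ sz1).
  by rewrite coefB coefZ lD /k divfK // subrr.
exists (Q + k *: 'X^(n.+1)); split.
- rewrite (leq_trans (size_polyD _ _)) // geq_max (leq_trans szQ) //.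
  by rewrite (leq_trans (size_scale_leq _ _)) // size_polyXn.
- by rewrite coefD coefZ coefXn eqxx mulr1 (leq_sizeP _ _ szQ) // add0r.
- by rewrite !hornerE Q0 /= expr0n mulr0 addr0.
- move=> m; rewrite !hornerE QS !hornerE /=.
  have -> : m.+1%:R - 1 = m%:R :> F by rewrite -natr1 addrK.
  by ring.
Qed.

(* A Lawrence-type decomposition of the open positive cone: the cone at the vertex [a] has its
   generators flipped towards increasing height [t]. *)
Lemma positive_cone_decomposition (F : realDomainType) (I : finType) (lam t : I -> F) :
  injective t -> (forall a, lam a != 0) -> 0 < \sum_a lam a ->
  [forall a, 0 < lam a]%:R =
  \sum_a \prod_(b | b != a) Num.sg (t b - t a) *
         [forall b, (b != a) ==> (0 < lam b * (t b - t a))]%:R :> F.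
Proof.
move=> inj_t lam0 sum_gt0.
pose act a := [forall b, (b != a) ==> (0 < lam b * (t b - t a))].
pose S := \prod_b Num.sg (lam b).
(* In an active term [lam b] and [t b - t a] have the same sign for all [b != a], so the product of
   signs is that of all the [lam b] with the factor at [a] removed. *)
have termE a : \prod_(b | b != a) Num.sg (t b - t a) * (act a)%:R =
    S * Num.sg (lam a) * (act a)%:R.
  case: (boolP (act a)) => [/forallP acta|_]; last by rewrite !mulr0.
  rewrite !mulr1 /S [in RHS](bigD1 a) //= mulrAC -sgrM -expr2 sgrX sqr_sg lam0 mul1r.
  apply: eq_bigr => b nba; have := acta b; rewrite nba /=.
  rewrite -sgr_gt0 sgrM; case: (sgrP (lam b)); case: (sgrP (t b - t a));
  by rewrite ?(mulr0, mulrN, mulr1, ltxx, oppr_gt0, ltr10, ltr0N1) //; lra.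
rewrite (eq_bigr _ (fun a _ => termE a)).
have [p0 p0_gt0] : exists p, 0 < lam p.
  apply/existsP; apply: contraLR sum_gt0; rewrite negb_exists -leNgt => /forallP H.
  by apply: sumr_le0 => a _; rewrite leNgt.
(* Only two indices can be active: the lowest [p] with [lam p > 0] and the highest [q] with
   [lam q < 0]. If no [lam] is negative, [p] alone contributes [1]; otherwise both are active
   exactly when [t q < t p], and their terms have opposite signs. *)
have [p p_gt0 pmin] := @arg_minP _ _ _ p0 (fun a => 0 < lam a) t p0_gt0.
have neg a : (lam a < 0) = ~~ (0 < lam a) by rewrite -leNgt le_eqVlt (negPf (lam0 a)).
case: (boolP [forall a, 0 < lam a]) => [/forallP pos|].
  have S1 : S = 1 by apply: big1 => b _; rewrite gtr0_sg.
  rewrite (bigD1 p) //= big1 => [|a nap]; last first.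
    rewrite (_ : act a = false) ?mulr0 //; apply/negbTE/forallP => /(_ p).
    rewrite eq_sym nap /= pmulr_rgt0 // subr_gt0 ltNge pmin //.
  rewrite S1 gtr0_sg // addr0 !mul1r (_ : act p) //.
  apply/forallP => b; apply/implyP => nbp; rewrite pmulr_rgt0 // subr_gt0.
  by rewrite lt_neqAle (inj_eq inj_t) eq_sym nbp pmin.
rewrite negb_forall => /existsP[q0]; rewrite -neg => q0_lt0.
have [q q_lt0 qmax] := @arg_maxP _ _ _ q0 (fun a => lam a < 0) t q0_lt0.
have npq : q != p by apply: contraTneq q_lt0 => ->; rewrite -leNgt ltW.
have actp : act p = (t q < t p).
  apply/forallP/idP => [/(_ q)|qp b]; first by rewrite npq nmulr_rgt0 // subr_lt0.
  apply/implyP => nbp; case: (boolP (0 < lam b)) => [lb|]; last rewrite -neg => lb.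
    by rewrite pmulr_rgt0 // subr_gt0 lt_neqAle (inj_eq inj_t) eq_sym nbp pmin.
  by rewrite nmulr_rgt0 // subr_lt0 (le_lt_trans (qmax _ lb)).
have actq : act q = (t q < t p).
  apply/forallP/idP => [/(_ p)|qp b]; first by rewrite eq_sym npq pmulr_rgt0 // subr_gt0.
  apply/implyP => nbq; case: (boolP (0 < lam b)) => [lb|]; last rewrite -neg => lb.
    by rewrite pmulr_rgt0 // subr_gt0 (lt_le_trans qp) ?pmin.
  by rewrite nmulr_rgt0 // subr_lt0 lt_neqAle (inj_eq inj_t) nbq; apply: qmax.
rewrite (bigD1 p) //= (bigD1 q) //= big1 => [|a /andP[nap naq]]; last first.
  rewrite (_ : act a = false) ?mulr0 //; apply/negbTE/forallP => acta.
  case: (boolP (0 < lam a)) => [la|]; last rewrite -neg => la.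
    by have := acta p; rewrite eq_sym nap pmulr_rgt0 // subr_gt0 ltNge pmin.
  by have := acta q; rewrite eq_sym naq nmulr_rgt0 // subr_lt0 ltNge (qmax _ la : t a <= t q).
by rewrite actp actq gtr0_sg // ltr0_sg //; ring.
Qed.

(* Integral of a B-spline with integer knots as a sum over the integers. *)
Lemma truncated_power_sum (F : numFieldType) (d : nat) (tau : 'I_d.+2 -> int) (T : int) :
  injective tau -> (forall a, tau a <= T) ->
  \sum_a (\sum_(j < `|T - tau a|) j.+1%:R ^+ d) / \prod_(b | b != a) (tau b - tau a)%:~R
    = d.+1%:R^-1 :> F.
Proof.
move=> inj_tau tauT; have [Q [szQ lQ QE]] := power_sum_poly F d.
(* With negated nodes the denominators become products of [tau b - tau a], and [Q \Po Y] takes at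
   the node of [a] the value [Q] at [T - tau a], a power sum. *)
have injF : injective (fun a => - (tau a)%:~R : F).
  by move=> a b /oppr_inj /intr_inj /inj_tau.
pose Y : {poly F} := 'X + (T%:~R)%:P.
have szY : size Y = 2 by rewrite size_XaddC.
have sz1 : (size (Q \Po Y) <= d.+2)%N by rewrite size_comp_poly2.
have := lagrange_lead_coef injF sz1.
have -> : (Q \Po Y)`_d.+1 = d.+1%:R^-1.
  rewrite -lQ; move: szQ; rewrite leq_eqVlt => /predU1P[szQ|szQ].
    have := lead_coef_comp Q (_ : 1 < size Y)%N; rewrite szY => /(_ isT).
    rewrite /lead_coef size_comp_poly2 // szQ szY /= => ->.
    by rewrite coefD coefX coefC addr0 expr1n mulr1.
  rewrite (leq_sizeP _ _ szQ) //.
  by apply: (leq_sizeP _ d.+1 _) => //; rewrite size_comp_poly2.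
move=> <-; apply: eq_bigr => a _; rewrite -QE; congr (_ / _); last first.
  by apply: eq_bigr => b _; rewrite rmorphB /=; ring.
rewrite horner_comp /Y !hornerE; congr (Q.[_]).
have := tauT a; rewrite -subr_ge0 => /gez0_abs; case: (T - tau a) (subrK (tau a) T) => // k <- _.
by rewrite rmorphD /=; ring.
Qed.

(** * Simplices in homogeneous coordinates *)

Lemma prod_lift (R : comPzRingType) d (a : 'I_d.+1) (f : 'I_d.+1 -> R) :
  \prod_(b | b != a) f b = \prod_i f (lift a i).
Proof.
rewrite (reindex_omap (lift a) (unlift a)) /=; last first.
  by move=> i nia; case: unliftP nia => [j ->|->]; rewrite ?eqxx.
by apply: eq_bigl => i; rewrite liftK eqxx eq_sym neq_lift.
Qed.

Section Simplices.
Variable F : archiRealFieldType.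
Implicit Types (x y a b : nat -> F).

(** Points are sequences whose entry [0] is the weight and of which dimension [d] reads the entries
    up to [d]. Projections then leave a point unchanged, and recursion on the dimension needs no
    casts. *)
Definition homog_mx d (w : 'I_d.+1 -> nat -> F) : 'M[F]_d.+1 := \matrix_(i, j) w i j.

Definition bary d (w : 'I_d.+1 -> nat -> F) y (i : 'I_d.+1) : F :=
  ((\row_j y (nat_of_ord j)) *m invmx (homog_mx w)) 0 i.

Lemma baryE d (w : 'I_d.+1 -> nat -> F) y j : homog_mx w \in unitmx -> (j <= d)%N ->
  y j = \sum_i bary w y i * w i j.
Proof.
move=> wu; rewrite -ltnS => ltj.
have /rowP/(_ (Ordinal ltj)) := mulmxKV wu (\row_j y (nat_of_ord j)).
by rewrite !mxE /= => <-; apply: eq_bigr => i _; rewrite [homog_mx w _ _]mxE.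
Qed.

Lemma bary_uniq d (w : 'I_d.+1 -> nat -> F) y lam : homog_mx w \in unitmx ->
  (forall j, (j <= d)%N -> y j = \sum_i lam i * w i j) -> bary w y =1 lam.
Proof.
move=> wu ylam i; rewrite /bary.
have -> : (\row_j y (nat_of_ord j)) = (\row_i lam i) *m homog_mx w.
    apply/rowP => j; rewrite !mxE ylam; last by rewrite -ltnS.
  by apply: eq_bigr => k _; rewrite !mxE.
by rewrite mulmxK // mxE.
Qed.

(* In homogeneous coordinates: the points of the affine image, one dimension lower, of the lines
   joining [a] to [b], and the corresponding linear map on weighted points. *)
Definition slope a b : nat -> F := fun j => (b j.+1 - a j.+1) / (b 1%N - a 1%N).

Definition shift a y : nat -> F := fun j => y j.+1 - y 0%N * a j.+1.

Definition slopes d (w : 'I_d.+2 -> nat -> F) (a : 'I_d.+2) : 'I_d.+1 -> nat -> F :=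
  fun i => slope (w a) (w (lift a i)).

Lemma det_slopes d (w : 'I_d.+2 -> nat -> F) (a : 'I_d.+2) :
  (forall i, w i 0%N = 1) -> (forall i, i != a -> w i 1%N != w a 1%N) ->
  `|\det (homog_mx w)| = \prod_(b | b != a) `|w b 1%N - w a 1%N| * `|\det (homog_mx (slopes w a))|.
Proof.
move=> w0 w1.
(* Multiplying by [C] subtracts from each column [j != 0] the multiple [w a j] of the column of
   ones. Row [a] becomes the first unit vector, and the other rows become differences to [w a]. *)
pose C : 'M[F]_d.+2 := \matrix_(i, j)
  (if i == j then 1 else if i == 0 then - w a j else 0).
have detC : \det C = 1.
  rewrite -det_tr det_trig; last first.
    apply/is_trig_mxP => i j ltij; rewrite !mxE.
    by rewrite -!val_eqE /= gtn_eqF // gtn_eqF // (leq_ltn_trans _ ltij).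
  by apply: big1 => i _; rewrite !mxE eqxx.
have MCE i j : (homog_mx w *m C) i j = if j == 0 then 1 else w i j - w a j.
  rewrite mxE (bigD1 j) //= !mxE eqxx mulr1.
  case: eqVneq => [->|nj0].
    rewrite big1 ?addr0 ?w0 // => k nk0; rewrite !mxE (negPf nk0) mulr0 //.
  rewrite (bigD1 0) /=; last by rewrite eq_sym.
  rewrite !mxE eq_sym (negPf nj0) eqxx w0 mul1r big1 ?addr0 // => k /andP[nkj nk0].
  by rewrite !mxE (negPf nkj) (negPf nk0) mulr0.
have -> : \det (homog_mx w) = \det (homog_mx w *m C) by rewrite det_mulmx detC mulr1.
rewrite (expand_det_row _ a) (bigD1 0) //= big1 ?addr0; last first.
  by move=> j nj0; rewrite MCE (negPf nj0) subrr mul0r.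
rewrite MCE eqxx mul1r /cofactor normrM normrX normrN1 expr1n mul1r.
rewrite -normr_prod prod_lift -normrM; congr `|_|.
have -> : row' a (col' 0 (homog_mx w *m C)) =
   diag_mx (\row_i (w (lift a i) 1%N - w a 1%N)) *m homog_mx (slopes w a).
  apply/matrixP => i j; rewrite mul_diag_mx !mxE.
  have := MCE (lift a i) (lift 0 j); rewrite !mxE => ->.
  rewrite eq_sym (negPf (neq_lift _ _)) /slopes /slope lift0 mulrC divfK //.
  by rewrite subr_eq0 w1 // eq_sym neq_lift.
by rewrite det_mulmx det_diag; congr (_ * _); apply: eq_bigr => i _; rewrite mxE.
Qed.

Lemma unit_slopes d (w : 'I_d.+2 -> nat -> F) (a : 'I_d.+2) :
  (forall i, w i 0%N = 1) -> (forall i, i != a -> w i 1%N != w a 1%N) ->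
  (homog_mx (slopes w a) \in unitmx) = (homog_mx w \in unitmx).
Proof.
move=> w0 w1; rewrite !unitmxE !unitfE -[in LHS]normr_eq0 -[\det (homog_mx w) == 0]normr_eq0
    (det_slopes w0 w1).
rewrite mulf_eq0 negb_or; case: eqP => //= /eqP; rewrite ?andbT ?andbF // => _.
by symmetry; apply/prodf_neq0 => b nba; rewrite normr_eq0 subr_eq0 w1.
Qed.

(** In [y - y_0 a] the vertex [a] drops out and [b - a] is [b_1 - a_1] times a slope. The sign
    condition of the flipped cone at [a] is thus positivity of the coordinates in the simplex of
    slopes. *)
Lemma bary_slopes d (w : 'I_d.+2 -> nat -> F) (a : 'I_d.+2) y :
  (forall i, w i 0%N = 1) -> (forall i, i != a -> w i 1%N != w a 1%N) ->
  homog_mx w \in unitmx -> forall i,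
  bary (slopes w a) (shift (w a) y) i =
    bary w y (lift a i) * (w (lift a i) 1%N - w a 1%N).
Proof.
move=> w0 w1 wu; apply: bary_uniq => [|j ltj]; first by rewrite unit_slopes.
rewrite /shift (baryE y wu (ltj : (j.+1 <= d.+1)%N)) (baryE y wu (leq0n _)) mulr_suml -sumrB.
rewrite (bigD1_ord a) //= w0 mulr1 subrr add0r; apply: eq_bigr => i _.
rewrite /slopes /slope w0 mulr1 -mulrBr -mulrA; congr (_ * _).
by rewrite mulrC divfK // subr_eq0 w1 // eq_sym neq_lift.
Qed.

(* The recursive conditions (a) and (b) on the vertices [v], unfolded: in each dimension, affine
   independence after projection and integrality of the affine hull. *)
Definition flag_integral d n (v : 'I_n -> nat -> F) :=
  forall k, (k < d)%N -> forall u : 'I_k.+1 -> 'I_n, injective u ->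
  homog_mx (v \o u) \in unitmx /\
  exists c : nat -> int, forall i, v (u i) k.+1 = \sum_(j < k.+1) (c j)%:~R * v (u i) j.

Lemma flag_integral_comp d n m (v : 'I_n -> nat -> F) (g : 'I_m -> 'I_n) :
  injective g -> flag_integral d v -> flag_integral d (v \o g).
Proof.
move=> inj_g fv k ltk u inj_u.
exact: (fv k ltk (g \o u) (inj_comp inj_g inj_u)).
Qed.

Lemma flag_integral_neq1 d n (v : 'I_n -> nat -> F) (i j : 'I_n) :
  (forall i, v i 0%N = 1) -> flag_integral d.+2 v -> i != j -> v i 1%N != v j 1%N.
Proof.
move=> v0 fv nij; apply/eqP => eqv.
pose u (k : 'I_2) := if k == 0 then i else j.
have inj_u : injective u.
  by case=> [[|[|//]] ?] [[|[|//]] ?] //=; rewrite /u /= => E; try exact: val_inj;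
     move: nij; rewrite E eqxx.
have [+ _] := fv 1%N isT u inj_u; rewrite unitmxE unitfE.
have -> : \det (homog_mx (v \o u)) = 0; last by rewrite eqxx.
apply: (@determinant_alternate _ _ _ 0 1) => // -[[|[|//]] ?]; rewrite !mxE /u /= ?v0 //.
Qed.

(** Each coordinate is an integral combination of the earlier ones by the equation of a hyperplane
    through enough vertices. The transposition brings [i] among the chosen vertices, and [d <= n]
    ensures that there are enough. *)
Lemma flag_integral_int d n (v : 'I_n -> nat -> F) i j :
  (forall i, v i 0%N = 1) -> flag_integral d v -> (d <= n)%N -> (j <= d)%N ->
  v i j \is a Num.int.
Proof.
move=> v0 fv dn; elim/ltn_ind: j i => -[|j] IH i ltj; first by rewrite v0.
have n0 : (0 < n)%N by apply: leq_ltn_trans (ltn_ord i).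
pose u (k : 'I_j.+1) := tperm (Ordinal n0) i (widen_ord (leq_trans ltj dn) k).
have inj_u : injective u by move=> k l /perm_inj /(congr1 val) /= ?; exact: val_inj.
have [_ [c cE]] := fv j ltj u inj_u.
have ui : u 0 = i by rewrite /u (_ : widen_ord _ _ = Ordinal n0) ?tpermL //; exact: val_inj.
rewrite -ui cE; apply: rpred_sum => k _; rewrite rpredM ?intr_int // ui.
by rewrite IH // (leq_trans (ltnW (ltn_ord k))).
Qed.

(** Apply the hypothesis to the chosen vertices together with [a]. Subtracting the equation at [a]
    cancels [c 0], and dividing by [b_1 - a_1] keeps the other coefficients: [c 1] becomes the new
    constant term. *)
Lemma flag_integral_slopes d (w : 'I_d.+2 -> nat -> F) (a : 'I_d.+2) :
  (forall i, w i 0%N = 1) -> flag_integral d.+1 w -> flag_integral d (slopes w a).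
Proof.
move=> w0 fw k ltk u inj_u; case: d w a w0 fw ltk u inj_u => // d w a w0 fw ltk u inj_u.
have w1 i j : i != j -> w i 1%N != w j 1%N by apply: flag_integral_neq1 fw.
pose u' (i : 'I_k.+2) := if unlift 0 i is Some i' then lift a (u i') else a.
have inj_u' : injective u'.
  move=> i j; rewrite /u'; case: unliftP => [i' ->|->]; case: unliftP => [j' ->|->] //.
  - by move=> /lift_inj /inj_u ->.
  - by move=> /eqP; rewrite eq_sym (negPf (neq_lift _ _)).
  - by move=> /eqP; rewrite (negPf (neq_lift _ _)).
have u'0 : u' 0 = a by rewrite /u' unlift_none.
have u'S i : u' (lift 0 i) = lift a (u i) by rewrite /u' liftK.
have [un [c cE]] := fw k.+1 ltk u' inj_u'.
split.
  have -> : homog_mx (slopes w a \o u) = homog_mx (slopes (w \o u') 0).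
    by apply/matrixP => i j; rewrite !mxE /slopes /= u'0 u'S.
  rewrite unit_slopes // => i => [|ni0]; first exact: w0.
  by apply: w1; rewrite (inj_eq inj_u').
exists (fun j => c j.+1) => i; rewrite /slopes /slope.
have := cE (lift 0 i); have := cE 0; rewrite u'0 u'S => -> ->.
rewrite -sumrB big_ord_recl !w0 subrr add0r mulr_suml.
by apply: eq_bigr => j _; rewrite lift0 -mulrBr mulrA.
Qed.

End Simplices.

(** * Lattice points of simplices *)

Definition irange (B : nat) : seq int := [seq i%:Z - B%:Z | i <- iota 0 B.*2].

Fixpoint box (B d : nat) : seq (seq int) :=
  if d is d'.+1 then [seq z0 :: z | z0 <- irange B, z <- box B d'] else [:: [::]].

Lemma mem_irange B (z : int) : (z \in irange B) = (- B%:Z <= z < B%:Z).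
Proof.
apply/mapP/idP => [[i]|Hz]; first by rewrite mem_iota => Hi ->; lia.
by exists (absz (z + B%:Z)); rewrite ?mem_iota; lia.
Qed.

Lemma irange_uniq B : uniq (irange B).
Proof. by rewrite map_inj_uniq ?iota_uniq // => i j; lia. Qed.

Lemma mem_box B d (z : seq int) :
  (z \in box B d) = (size z == d) && all (mem (irange B)) z.
Proof.
elim: d z => [|d IH] [|z0 z] //=.
  by apply/negbTE/negP => /allpairsP [p []].
rewrite eqSS andbCA -IH; apply/allpairsP/andP => [[[a b] [/= ? ? [-> ->]]]|[? ?]] //.
by exists (z0, z).
Qed.

Lemma box_uniq B d : uniq (box B d).
Proof.
elim: d => //= d IH; apply: allpairs_uniq => //; first exact: irange_uniq.
by move=> [a b] [a' b'] _ _ /= [-> ->].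
Qed.

(** * Sums over all integer points *)

Section EventualSums.
Variable R : pzRingType.
Implicit Types f g : seq int -> R.

(** Stands for [m] being the sum of [f] over [Z^d]. Eventually constant box sums add up and split
    off a coordinate without any description of the support of [f]. *)
Definition evsum d f (m : R) :=
  exists B0, forall B, (B0 <= B)%N -> \sum_(z <- box B d) f z = m.

Lemma eq_evsum d f g m : (forall z, size z = d -> f z = g z) -> evsum d f m -> evsum d g m.
Proof.
move=> fg [B0 H]; exists B0 => B /H <-; apply: eq_big_seq => z.
by rewrite mem_box => /andP[/eqP /fg ->].
Qed.

Lemma evsum0 d : evsum d (fun=> 0) 0.
Proof. by exists 0%N => B _; rewrite big1. Qed.

Lemma evsumZ d f m c : evsum d f m -> evsum d (fun z => c * f z) (c * m).
Proof. by move=> [B0 H]; exists B0 => B /H <-; rewrite mulr_sumr. Qed.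

Lemma evsum_sum d (I : eqType) (r : seq I) (P : pred I) (f : I -> seq int -> R) (m : I -> R) :
  (forall i, i \in r -> P i -> evsum d (f i) (m i)) ->
  evsum d (fun z => \sum_(i <- r | P i) f i z) (\sum_(i <- r | P i) m i).
Proof.
elim: r => [_|i r IH H].
  by rewrite big_nil; apply: (eq_evsum _ (evsum0 d)) => z; rewrite big_nil.
have [|B0 H0] := IH; first by move=> j jr; apply: H; rewrite inE jr orbT.
case Pi : (P i); last first.
  by exists B0 => B /H0 E0; rewrite [RHS]big_cons Pi -E0; apply: eq_bigr => z; rewrite big_cons Pi.
have [B1 H1] := H i (mem_head _ _) Pi; exists (maxn B0 B1) => B.
rewrite geq_max => /andP[/H0 E0 /H1 E1]; rewrite [RHS]big_cons Pi -E0 -E1 -big_split /=.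
by apply: eq_bigr => z; rewrite big_cons Pi.
Qed.

Lemma sum_irange_sub (g : int -> R) B1 B : (B1 <= B)%N ->
  (forall z, z \notin irange B1 -> g z = 0) ->
  \sum_(z <- irange B) g z = \sum_(z <- irange B1) g z.
Proof.
move=> leB g0; rewrite (bigID (mem (irange B1))) /= addrC big1 ?add0r //.
rewrite -big_filter; apply: perm_big; apply: uniq_perm.
- by rewrite filter_uniq ?irange_uniq.
- exact: irange_uniq.
- by move=> z; rewrite mem_filter !mem_irange; lia.
Qed.

(** Fubini along the first coordinate. A bound [B1] on that coordinate leaves finitely many slices,
    whose thresholds have a common maximum. *)
Lemma evsum_cons d f (m : int -> R) B1 :
  (forall z0 z, z0 \notin irange B1 -> size z = d -> f (z0 :: z) = 0) ->
  (forall z0, z0 \in irange B1 -> evsum d (fun z => f (z0 :: z)) (m z0)) ->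
  evsum d.+1 f (\sum_(z0 <- irange B1) m z0).
Proof.
move=> f0 fm.
have [B0 H] := evsum_sum (P := xpredT) (fun i ir _ => fm i ir).
exists (maxn B0 B1) => B; rewrite geq_max => /andP[/H <- leB]; rewrite big_allpairs_dep.
rewrite (sum_irange_sub leB) => [|z0 nz0]; first exact: exchange_big.
rewrite big_seq big1 // => z; rewrite mem_box => /andP[/eqP sz _].
exact: f0.
Qed.

End EventualSums.

Lemma sum_irange_truncated_power (R : pzRingType) B (tau : int) d :
  - B%:Z <= tau < B%:Z ->
  \sum_(z <- irange B) (if tau < z then (z - tau)%:~R ^+ d else 0) =
  \sum_(j < absz (B%:Z - 1 - tau)%R) j.+1%:R ^+ d :> R.
Proof.
move=> Htau; rewrite big_map.
have -> : (B.*2 = absz (tau + B%:Z + 1)%R + absz (B%:Z - 1 - tau)%R)%N by lia.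
rewrite iotaD big_cat /= big1_seq ?add0r; last first.
  by move=> i; rewrite mem_iota andTb => Hi; case: ltP => //; lia.
rewrite add0n -[X in iota X _]addn0 iotaDl big_map -(subn0 (absz (B%:Z - 1 - tau)%R)).
rewrite -/(index_iota 0 _) big_mkord subn0; apply: eq_bigr => i _.
rewrite ifT; last by lia.
have -> : (absz (tau + B%:Z + 1)%R + i)%N%:Z - B%:Z - tau = i.+1%:Z by lia.
by [].
Qed.

(** * Shifted lattice points and their count in an integral simplex *)

Section SimplexCount.
Variable F : archiRealFieldType.
Implicit Types (c : nat -> int) (z : seq int).

Variable s : F.

(** Index [d] is the last coordinate, so slicing keeps the shift last. Only the slicing of a
    one-dimensional simplex moves it, into the weight. *)
Definition last_shift (d j : nat) : F := if j == d then s else 0.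

(* Homogeneous coordinates, of weight [n], of the point [z - c] lowered by [s]; for [0 < s < 1] it
   lies on no facet hyperplane of an integral simplex. *)
Definition low_point d (n : F) c z : nat -> F :=
  fun j => if j is j'.+1 then (z`_j' - c j')%:~R - last_shift d j else n.

Definition open_cone d (w : 'I_d.+1 -> nat -> F) y := [forall i, 0 < bary w y i].

(** A slice at first coordinate [z0] is the same counting problem one dimension lower, with weight
    the height of [z0] above the dilated vertex and a translation that has absorbed [N] times the
    vertex. *)
Lemma shift_low_point d (N : int) c (z0 : int) z (a : nat -> F) (A : nat -> int) :
  (forall j, (0 < j <= d.+1)%N -> a j = (A j)%:~R) -> forall j, (j <= d)%N ->
  shift a (low_point d.+1 N%:~R c (z0 :: z)) j =
  low_point d ((z0 - c 0%N - N * A 1%N)%:~R - last_shift d.+1 1)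
    (fun j => c j.+1 + N * A j.+2) z j.
Proof.
move=> aA [|j] lej; rewrite /shift /low_point /= aA //.
  by rewrite !rmorphB rmorphM /=; ring.
rewrite !(rmorphB, rmorphD, rmorphM) /= /last_shift eqSS; ring.
Qed.

Lemma bary_ext d (w : 'I_d.+1 -> nat -> F) x y :
  (forall j, (j <= d)%N -> x j = y j) -> bary w x =1 bary w y.
Proof.
move=> xy i; rewrite /bary; congr ((_ *m _) _ _).
by apply/rowP => j; rewrite !mxE xy // -ltnS.
Qed.

Hypothesis s01 : 0 < s < 1.

Lemma int_subr_neq (a b : int) : a%:~R - s != b%:~R :> F.
Proof.
apply/eqP => E; case/andP: s01; have -> : s = (a - b)%:~R by rewrite rmorphB /= -E; ring.
rewrite ltr0z -[1]/(1%:~R) ltr_int; lia.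
Qed.

(** Passing to slopes at a vertex [a != b] only rescales the coordinate at [b], which reduces to
    dimension one. There a zero coordinate would make the point [N] times the other vertex, an
    integer equal to an integer minus [s]. *)
Lemma bary_low_point_neq0 d (w : 'I_d.+2 -> nat -> F) (N : int) c z b :
  (forall i, w i 0%N = 1) -> flag_integral d.+1 w -> homog_mx w \in unitmx ->
  bary w (low_point d.+1 N%:~R c z) b != 0.
Proof.
elim: d w N c z b => [|d IH] w N c z b w0 fw wu.
  apply/eqP => lb0; set y := low_point _ _ _ _ in lb0.
  have E0 := baryE y wu (leq0n 1); have E1 := baryE y wu (leqnn 1).
  pose a := lift b ord0.
  have sumE (g : 'I_2 -> F) : \sum_i g i = g b + g a.
    by rewrite (bigD1_ord b) //= big_ord1.
  rewrite !sumE lb0 !mul0r !add0r !w0 mulr1 in E0 E1.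
  have /intrP[t tE] : w a 1%N \is a Num.int by apply: flag_integral_int fw _ _.
  move: E1; rewrite -E0 tE /y /low_point /last_shift eqxx -intrM => /eqP.
  by rewrite (negPf (int_subr_neq _ _)).
pose a := lift b ord0; have nab : b != a by rewrite neq_lift.
have [b' bE] : exists b', b = lift a b'.
  by case: (unliftP a b) nab => [j ->|->]; [exists j | rewrite eqxx].
have w1 i : i != a -> w i 1%N != w a 1%N by apply: flag_integral_neq1 fw.
have wint j : (0 < j <= d.+2)%N -> w a j = (Num.floor (w a j))%:~R.
  move=> /andP[_ lej]; apply/esym/floorK.
  by apply: flag_integral_int fw _ _ => //; lia.
apply/eqP => lb0.
have : bary (slopes w a) (shift (w a) (low_point d.+2 N%:~R c z)) b' != 0.
  (* An empty [z] reads as zeros by the default of [nth], so [z] may be taken to be a cons. *)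
  have zE : shift (w a) (low_point d.+2 N%:~R c z) =1
            shift (w a) (low_point d.+2 N%:~R c (z`_0 :: behead z)).
    by move=> j; rewrite /shift /low_point; case: (z); case: j => //= j; rewrite nth_nil.
  rewrite (bary_ext _ (fun j _ => zE j)) (bary_ext _ (shift_low_point N c _ _ wint)).
  rewrite /last_shift /= subr0; apply: IH.
  - by move=> i; rewrite /slopes /slope divff // subr_eq0 w1 // eq_sym neq_lift.
  - exact: flag_integral_slopes.
  - by rewrite unit_slopes.
by rewrite bary_slopes // -bE lb0 mul0r eqxx.
Qed.

End SimplexCount.

Section SimplexCount.
Variables (F : archiRealFieldType) (s : F).
Hypothesis s01 : 0 < s < 1.
Implicit Types (c : nat -> int) (z : seq int).

Lemma open_cone_slopes d (w : 'I_d.+2 -> nat -> F) (a : 'I_d.+2) y :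
  (forall i, w i 0%N = 1) -> (forall i, i != a -> w i 1%N != w a 1%N) ->
  homog_mx w \in unitmx ->
  open_cone (slopes w a) (shift (w a) y) =
  [forall b, (b != a) ==> (0 < bary w y b * (w b 1%N - w a 1%N))].
Proof.
move=> w0 w1 wu; apply/forallP/forallP => H b; last first.
  by rewrite bary_slopes //; have := H (lift a b); rewrite eq_sym neq_lift.
by apply/implyP; case: (unliftP a b) => [b' -> _|->]; rewrite ?eqxx // -bary_slopes.
Qed.

Lemma open_cone_ext d (w : 'I_d.+1 -> nat -> F) x y :
  (forall j, (j <= d)%N -> x j = y j) -> open_cone w x = open_cone w y.
Proof. by move=> xy; apply: eq_forallb => i; rewrite (bary_ext _ xy). Qed.

Lemma open_cone_weight d (w : 'I_d.+1 -> nat -> F) y :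
  (forall i, w i 0%N = 1) -> homog_mx w \in unitmx -> open_cone w y -> 0 < y 0%N.
Proof.
move=> w0 wu /forallP H; rewrite (baryE _ wu) //.
under eq_bigr do rewrite w0 mulr1.
by rewrite big_ord_recl ltr_pwDl // sumr_ge0 // => i _; apply: ltW.
Qed.

(** The weight [n] may be non-integral for [d = 0] because slices of a segment have weight an
    integer minus [s]; the count is then [1] whatever [n > 0] is. *)
Theorem count_simplex d (w : 'I_d.+1 -> nat -> F) (n : F) c :
  (forall i, w i 0%N = 1) -> flag_integral d w -> homog_mx w \in unitmx ->
  0 < n -> (d != 0%N -> n \is a Num.int) ->
  evsum d (fun z => (open_cone w (low_point s d n c z))%:R)
    (n ^+ d * `|\det (homog_mx w)| / d`!%:R).
Proof.
elim: d w n c => [|d IH] w n c w0 fw wu n_gt0 n_int.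
  exists 0%N => B _; rewrite big_seq1 expr0 det_mx11 mxE w0 normr1 mulr1 divr1.
  suff -> : open_cone w (low_point s 0 n c [::]) by [].
  apply/forallP => i; have := baryE (low_point s 0 n c [::]) wu (leqnn 0).
  by rewrite big_ord1 w0 mulr1 (ord1 i) => <-.
have /intrP[N nN] := n_int isT; rewrite {n n_int}nN in n_gt0 *.
have N_gt0 : 0 < N by rewrite ltr0z in n_gt0.
have wint' i j : (0 < j <= d.+1)%N -> w i j = (Num.floor (w i j))%:~R.
  by move=> /andP[_ lej]; apply/esym/floorK; apply: flag_integral_int fw _ _.
pose t i := Num.floor (w i 1%N).
have tE i : w i 1%N = (t i)%:~R by rewrite [LHS]wint'.
have inj_w1 : injective (fun i => w i 1%N).
  move=> i j /= wij; apply/eqP/negPn/negP => nij.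
  (* In dimension one [flag_integral] says nothing about pairs of vertices; equal endpoints are
     excluded by the determinant instead. *)
  case: (d) w w0 fw wu {IH wint' t tE} i j nij wij => [|d'] w w0 fw wu i j nij wij.
    move: wu; rewrite unitmxE unitfE; have -> : \det (homog_mx w) = 0; last by rewrite eqxx.
    apply: (determinant_alternate nij) => -[[|[|//]] ?]; rewrite !mxE ?w0 //.
  by have := flag_integral_neq1 w0 fw nij; rewrite wij eqxx.
have w1 a i : i != a -> w i 1%N != w a 1%N by rewrite (inj_eq inj_w1).
pose tau a : int := c 0%N + N * t a.
have tau_inj : injective tau.
  by move=> a b /addrI /(mulfI (lt0r_neq0 N_gt0)) tab; apply: inj_w1; rewrite /= !tE tab.
(* The margin of two beyond all vertex heights [tau a] keeps the slices outside the range clear of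
   the simplex even after the shift. *)
pose B1 := (\sum_a absz (tau a)).+2.
have tauB a : (absz (tau a))%:Z <= B1%:Z - 2.
  by have : (absz (tau a) <= \sum_a absz (tau a))%N; [rewrite (bigD1 a) //= leq_addr | lia].
pose eps a : F := \prod_(b | b != a) Num.sg (w b 1%N - w a 1%N).
pose D a := `|\det (homog_mx (slopes w a))| / d`!%:R.
pose y z : nat -> F := low_point s d.+1 N%:~R c z.
have y'0 (z0 : int) z a : shift (w a) (y (z0 :: z)) 0%N = (z0 - tau a)%:~R - last_shift s d.+1 1.
  rewrite (@shift_low_point _ _ _ _ _ _ _ _ (fun j => Num.floor (w a j)) (wint' a)) //=.
  by rewrite opprD addrA.
have s0 a i : slopes w a i 0%N = 1.
  by rewrite /slopes /slope divff // subr_eq0 w1 // eq_sym neq_lift.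
have su a : homog_mx (slopes w a) \in unitmx by rewrite unit_slopes //; apply: w1.
have half_le1 : 0 <= last_shift s d.+1 1 < 1.
  by rewrite /last_shift; case/andP: s01 => ? ?; case: ifP => _; lra.
have posE z : (open_cone w (y z))%:R =
    \sum_a eps a * (open_cone (slopes w a) (shift (w a) (y z)))%:R :> F.
  rewrite {1}/open_cone (positive_cone_decomposition inj_w1).
  - by apply: eq_bigr => a _; rewrite open_cone_slopes //; apply: w1.
  - by move=> a; apply: bary_low_point_neq0.
  - have -> : \sum_a bary w (y z) a = y z 0%N; last exact: n_gt0.
    by rewrite [RHS](baryE _ wu) //; apply: eq_bigr => a _; rewrite w0 mulr1.
(* The height of a point averages the heights of the vertices. Outside the range all these
   differences have one sign, so the coordinates cannot all be positive. *)
have bary_sum z : \sum_a bary w (y z) a * (y z 1%N - N%:~R * w a 1%N) = 0.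
  under eq_bigr do rewrite mulrBr mulrCA; rewrite sumrB -mulr_suml -mulr_sumr -baryE //.
  have -> : \sum_a bary w (y z) a = N%:~R.
    by rewrite -[RHS]/(y z 0%N) (baryE _ wu) //; apply: eq_bigr => a _; rewrite w0 mulr1.
  by rewrite subrr.
have -> : N%:~R ^+ d.+1 * `|\det (homog_mx w)| / (d.+1)`!%:R =
    \sum_(z0 <- irange B1) \sum_a eps a *
      (if tau a < z0 then (z0 - tau a)%:~R ^+ d * D a else 0).
  rewrite exchange_big /=.
  (* By [det_slopes], [D a] is the determinant of [w] over [d!] and the absolute differences
     [w b 1 - w a 1]. The sign [eps a] makes these differences signed, and [N ^+ d.+1] rescales them
     to differences of [tau]: the form required by [truncated_power_sum] with [T = B1 - 1]. *)
  have E a : \sum_(z0 <- irange B1) eps a *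
      (if tau a < z0 then (z0 - tau a)%:~R ^+ d * D a else 0) =
      N%:~R ^+ d.+1 * `|\det (homog_mx w)| / d`!%:R *
      ((\sum_(j < absz ((B1%:Z - 1) - tau a)%R) j.+1%:R ^+ d)
       / \prod_(b | b != a) (tau b - tau a)%:~R).
    rewrite -sum_irange_truncated_power; last by have := tauB a; lia.
    rewrite -mulr_sumr.
    have -> : \sum_(z0 <- irange B1) (if tau a < z0 then (z0 - tau a)%:~R ^+ d * D a else 0)
       = (\sum_(z0 <- irange B1) (if tau a < z0 then (z0 - tau a)%:~R ^+ d else 0)) * D a.
      by rewrite mulr_suml; apply: eq_bigr => z0 _; case: ifP; rewrite ?mul0r.
    rewrite mulrCA [RHS]mulrCA; congr (_ * _).
    have -> : \prod_(b | b != a) (tau b - tau a)%:~R =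
        N%:~R ^+ d.+1 * \prod_(b | b != a) (w b 1%N - w a 1%N) :> F.
      have -> : N%:~R ^+ d.+1 = \prod_(b | b != a) N%:~R :> F.
        by rewrite prodr_const cardC1 card_ord.
      rewrite -big_split /=; apply: eq_bigr => b _.
      by rewrite /tau !tE !(rmorphB, rmorphD, rmorphM) /=; ring.
    rewrite (det_slopes w0 (w1 a)) /D /eps.
    have -> : \prod_(b | b != a) `|w b 1%N - w a 1%N| =
      (\prod_(b | b != a) Num.sg (w b 1%N - w a 1%N)) * \prod_(b | b != a) (w b 1%N - w a 1%N).
      by rewrite -big_split; apply: eq_bigr => b _; rewrite normrEsg.
    have : \prod_(b | b != a) (w b 1%N - w a 1%N) != 0.
      by apply/prodf_neq0 => b nba; rewrite subr_eq0 w1.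
    have Nd : N%:~R ^+ d.+1 != 0 :> F by rewrite expf_neq0 // lt0r_neq0.
    have d0 : d`!%:R != 0 :> F by rewrite pnatr_eq0 -lt0n fact_gt0.
    move: (\prod_(b | b != a) _) => P P0; move: (\prod_(b | b != a) _) => e.
    by move: (N%:~R ^+ d.+1) Nd => Q Q0; field; rewrite d0 P0 Q0.
  rewrite (eq_bigr _ (fun a _ => E a)) -mulr_sumr.
  rewrite truncated_power_sum //; last by move=> a; have := tauB a; lia.
  have d0 : d`!%:R != 0 :> F by rewrite pnatr_eq0 -lt0n fact_gt0.
  have d1 : d.+1%:R != 0 :> F by rewrite pnatr_eq0.
  rewrite factS natrM; move: (d.+1%:R) d1 => e e0; field; by rewrite d0 e0.
apply: evsum_cons => [z0 z nz0 _|z0 _].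
  suff -> : open_cone w (y (z0 :: z)) = false by [].
  apply/negbTE/negP => /forallP H; move: (bary_sum (z0 :: z)) => /eqP; apply/negP.
  have y1 a : y (z0 :: z) 1%N - N%:~R * w a 1%N = (z0 - tau a)%:~R - last_shift s d.+1 1.
    by rewrite -(y'0 z0 z).
  have [z0_ge|z0_lt] := leP B1%:Z z0.
    apply: lt0r_neq0; rewrite big_ord_recl ltr_pwDl ?sumr_ge0 // => [|i _].
      rewrite mulr_gt0 // y1 subr_gt0; case/andP: half_le1 => _ /lt_le_trans -> //.
      by rewrite (ler_int _ 1); have := tauB ord0; lia.
    rewrite mulr_ge0 ?ltW // y1 subr_gt0; case/andP: half_le1 => _ /lt_le_trans -> //.
    by rewrite (ler_int _ 1); have := tauB (lift ord0 i); lia.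
  have {}z0_lt : z0 < - B1%:Z by move: nz0; rewrite mem_irange; lia.
  apply: ltr0_neq0; rewrite -oppr_gt0 -sumrN big_ord_recl ltr_pwDl ?sumr_ge0 // => [|i _].
    rewrite oppr_gt0 pmulr_rlt0 // y1 subr_lt0; case/andP: half_le1 => + _.
    by apply: lt_le_trans; rewrite ltrz0; have := tauB ord0; lia.
  rewrite oppr_ge0 ltW // pmulr_rlt0 // y1 subr_lt0; case/andP: half_le1 => + _.
  by apply: lt_le_trans; rewrite ltrz0; have := tauB (lift ord0 i); lia.
apply: (@eq_evsum _ _
  (fun z => \sum_a eps a * (open_cone (slopes w a) (shift (w a) (y (z0 :: z))))%:R)) => [z _|].
  by rewrite -posE.
apply: evsum_sum => a _ _; apply: evsumZ.
(* The flipped cone lies strictly above its apex: at or below the height [tau a] the slice has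
   weight at most [0] and is empty. *)
case: ltP => [lt_tau|le_tau]; last first.
  apply: (eq_evsum _ (evsum0 _ _)) => z _; symmetry; apply/eqP.
  rewrite pnatr_eq0 eqb0; apply/negP => /(open_cone_weight (s0 a) (su a)).
  rewrite y'0 ltNge => /negP; apply.
  rewrite subr_le0; case/andP: half_le1 => + _; apply: le_trans.
  by rewrite lerz0; lia.
(* For [d = 0] the weight [m] contains [- s], but it enters the count only as [m ^+ 0]. *)
have [m [m_gt0 m_int mE]] : exists m : F, [/\ 0 < m, (d != 0%N -> m \is a Num.int) &
    m = (z0 - tau a)%:~R - last_shift s d.+1 1].
  exists ((z0 - tau a)%:~R - last_shift s d.+1 1); split => //.
    rewrite subr_gt0; case/andP: half_le1 => _ /lt_le_trans -> //.
    by rewrite (ler_int _ 1); lia.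
  by rewrite /last_shift eqSS eq_sym => /negPf ->; rewrite subr0 intr_int.
have -> : (z0 - tau a)%:~R ^+ d * D a = m ^+ d * `|\det (homog_mx (slopes w a))| / d`!%:R.
  rewrite /D mulrA; congr (_ * _ / _); rewrite mE /last_shift.
  by case: (d) => [|d']; rewrite ?expr0 //= subr0.
apply: (eq_evsum _ (IH _ m (fun j =>
    c j.+1 + N * Num.floor (w a j.+2)) (s0 a) _ (su a) m_gt0 m_int)); last first.
  exact: flag_integral_slopes.
move=> z _; congr (nat_of_bool _)%:R; apply: open_cone_ext => j lej.
rewrite (@shift_low_point _ _ _ _ _ _ _ _ (fun j => Num.floor (w a j)) (wint' a)) //=.
by rewrite mE /tau opprD addrA.
Qed.

End SimplexCount.

(** * Triangulation by generic heights *)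

Lemma exists_nonroot (F : numFieldType) (p : {poly F}) : p != 0 -> exists x, p.[x] != 0.
Proof.
move=> p0; apply: contrapT => nox.
have := @max_poly_roots _ p [seq i%:R | i <- iota 0 (size p)] p0.
rewrite map_inj_uniq; last by move=> i j /eqP; rewrite eqr_nat => /eqP.
rewrite size_map size_iota ltnn iota_uniq => /(_ _ isT) H.
suff : false by []; apply: H; apply/allP => x _; rewrite /root.
by apply/negPn/negP => px; apply: nox; exists x.
Qed.

(** The least ratio [mu i / al i] over positive [al i] is the longest step along [- al] that keeps
    all entries nonnegative; it annihilates entry [j]. This is the pivot rule of the simplex
    method. *)
Lemma ratio_test (F : realFieldType) (I : finType) (mu al : I -> F) (i0 : I) :
  (forall i, 0 <= mu i) -> 0 < al i0 ->
  exists j, [/\ 0 < al j, 0 <= mu j / al j & forall i, 0 <= mu i - mu j / al j * al i].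
Proof.
move=> mu0 al0.
have [j aj jmin] := @arg_minP _ _ _ i0 (fun i => 0 < al i) (fun i => mu i / al i) al0.
exists j; split=> //; first by rewrite divr_ge0 // ltW.
move=> i; rewrite subr_ge0; have [ai|ai] := ltP 0 (al i).
  by rewrite -ler_pdivlMr //; apply: jmin.
by apply: le_trans (mu0 i); rewrite mulr_ge0_le0 // divr_ge0 // ltW.
Qed.

Section Triangulation.
Variables (F : archiRealFieldType) (d n : nat) (v : 'I_n -> nat -> F) (i0 : 'I_n).
Hypothesis v0 : forall i, v i 0%N = 1.
Implicit Types (J W : {set 'I_n}) (mu : 'I_n -> F) (y : nat -> F).

Definition represents J y mu :=
  (forall i, i \notin J -> mu i = 0) /\
  forall j, (j <= d)%N -> y j = \sum_i mu i * v i j.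

Definition incone y := exists2 mu, forall i, 0 <= mu i & represents [set: 'I_n]%SET y mu.

Definition spanning J := forall y, exists mu, represents J y mu.

Definition simplex_of W : 'I_d.+1 -> nat -> F := fun k => v (nth i0 (enum W) k).

Definition basis W := (#|W| == d.+1) && (homog_mx (simplex_of W) \in unitmx).

(** Indexing coordinates by all vertices, with zeros outside [W], makes different bases comparable.
    For [#|W| = d.+1] the sum has at most one term. *)
Definition baryc W y i := \sum_(k < d.+1 | nth i0 (enum W) k == i) bary (simplex_of W) y k.

Lemma sum_nth_enum W mu (g : 'I_n -> F) : #|W| = d.+1 -> (forall i, i \notin W -> mu i = 0) ->
  \sum_i mu i * g i =
  \sum_(k < d.+1) mu (nth i0 (enum W) k) * g (nth i0 (enum W) k).
Proof.
move=> cW mu0; rewrite (bigID (mem W)) /= [X in _ + X]big1 ?addr0; last first.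
  by move=> i /mu0 ->; rewrite mul0r.
rewrite -big_enum (big_nth i0) big_mkord -cW cardE; exact: eq_bigr.
Qed.

Lemma nth_enum_inj W : #|W| = d.+1 -> injective (fun k : 'I_d.+1 => nth i0 (enum W) k).
Proof.
move=> cW k l /eqP; rewrite nth_uniq ?enum_uniq // -?cardE ?cW // => /eqP.
exact: val_inj.
Qed.

Lemma mem_nth_enum W (k : 'I_d.+1) : #|W| = d.+1 -> nth i0 (enum W) k \in W.
Proof. by move=> cW; rewrite -mem_enum mem_nth // -cardE cW. Qed.

Lemma baryc_nth W y (k : 'I_d.+1) : #|W| = d.+1 ->
  baryc W y (nth i0 (enum W) k) = bary (simplex_of W) y k.
Proof.
move=> cW; rewrite /baryc (bigD1 k) //= big1 ?addr0 // => l /andP[/eqP E].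
by rewrite (nth_enum_inj cW E) eqxx.
Qed.

Lemma nth_enum_surj W i : #|W| = d.+1 -> i \in W ->
  exists k : 'I_d.+1, i = nth i0 (enum W) k.
Proof.
move=> cW iW; have lt : (index i (enum W) < d.+1)%N by rewrite -cW cardE index_mem mem_enum.
by exists (Ordinal lt); rewrite nth_index // mem_enum.
Qed.

Lemma baryc_out W y i : #|W| = d.+1 -> i \notin W -> baryc W y i = 0.
Proof.
move=> cW iW; rewrite /baryc big1 // => k /eqP E.
by rewrite -E mem_nth_enum in iW.
Qed.

Lemma baryc_repr W y : basis W -> represents W y (baryc W y).
Proof.
move=> /andP[/eqP cW uW]; split => [i|j lej]; first exact: baryc_out.
rewrite (baryE y uW lej) (sum_nth_enum (v ^~ j) cW); last by move=> i; apply: baryc_out.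
by apply: eq_bigr => k _; rewrite baryc_nth.
Qed.

Lemma baryc_uniq W y mu : basis W -> represents W y mu -> baryc W y =1 mu.
Proof.
move=> /andP[/eqP cW uW] [mu0 yE] i.
have [iW|iW] := boolP (i \in W); last by rewrite mu0 // baryc_out.
have [k ->] := nth_enum_surj cW iW; rewrite baryc_nth //.
rewrite (bary_uniq (lam := fun k : 'I_d.+1 => mu (nth i0 (enum W) k)) uW) // => j lej.
by rewrite yE // (sum_nth_enum (v ^~ j) cW mu0).
Qed.

Lemma open_cone_simp W y : basis W -> open_cone (simplex_of W) y <-> (forall i, i \in W ->
    0 < baryc W y i).
Proof.
move=> /andP[/eqP cW uW]; split => [/forallP H i iW|H].
  by have [k ->] := nth_enum_surj cW iW; rewrite baryc_nth.
by apply/forallP => k; rewrite -baryc_nth // H // mem_nth_enum.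
Qed.

Lemma spanning_basis J : spanning J -> #|J| = d.+1 -> basis J.
Proof.
move=> sJ cJ; rewrite /basis cJ eqxx -row_full_unit -sub1mx; apply/row_subP => i.
have [mu [mu0 E]] := sJ (fun j => ((i : nat) == j)%:R).
apply/submxP; exists (\row_k mu (nth i0 (enum J) k)); apply/rowP => j.
rewrite !mxE -val_eqE E; last exact: (ltn_ord j).
rewrite (sum_nth_enum (v ^~ j) cJ mu0).
by apply: eq_bigr => k _; rewrite !mxE.
Qed.

Definition extend0 J (lam : 'I_#|J| -> F) i := \sum_(k | enum_val k == i) lam k.

Lemma ext_sum J lam (g : 'I_n -> F) :
  \sum_i extend0 lam i * g i = \sum_(k < #|J|) lam k * g (enum_val k).
Proof.
rewrite [RHS](partition_big (@enum_val _ _) xpredT) //=; apply: eq_bigr => i _.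
by rewrite mulr_suml; apply: eq_bigr => k /eqP <-.
Qed.

Lemma dependent J : (d.+1 < #|J|)%N ->
  exists al, [/\ exists i, 0 < al i, forall i, i \notin J -> al i = 0 &
    forall j, (j <= d)%N -> \sum_i al i * v i j = 0].
Proof.
move=> cJ; pose M := \matrix_(k < #|J|, j < d.+1) v (enum_val k) j.
have : kermx M != 0.
  by rewrite kermx_eq0 /row_free neq_ltn (leq_ltn_trans (rank_leq_col _) cJ).
case/rowV0Pn => lam /sub_kermxP lamM lam0.
have [k lamk] : exists k, lam 0 k != 0.
  apply/existsP; rewrite -negb_forall; apply: contra lam0 => /forallP H.
  by apply/eqP/rowP => k; rewrite mxE; apply/eqP.
(* The sign of a nonzero entry makes that entry positive, as [ratio_test] requires. *)
pose al i := Num.sg (lam 0 k) * extend0 (lam 0) i.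
exists al; split.
- exists (enum_val k); rewrite /al /extend0 (bigD1 k) //= big1 ?addr0; last first.
    by move=> l /andP[/eqP /enum_val_inj ->]; rewrite eqxx.
  by rewrite -normrEsg normr_gt0.
- move=> i iJ; rewrite /al /extend0 big1 ?mulr0 // => l /eqP E.
  by rewrite -E enum_valP in iJ.
- move=> j; rewrite -ltnS => lej; rewrite /al.
  under eq_bigr do rewrite -mulrA.
  rewrite -mulr_sumr ext_sum (_ : \sum_(_ < _) _ = 0) ?mulr0 //.
  have /rowP/(_ (Ordinal lej)) := lamM; rewrite !mxE => E; rewrite -[RHS]E.
  by apply: eq_bigr => l _; rewrite [M _ _]mxE.
Qed.

Lemma spanning_card J : spanning J -> (d.+1 <= #|J|)%N.
Proof.
move=> sJ; pose M := \matrix_(k < #|J|, j < d.+1) v (enum_val k) j.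
suff : row_full M by move=> /eqP <-; exact: rank_leq_row.
rewrite -sub1mx; apply/row_subP => i.
have [mu [mu0 E]] := sJ (fun j => ((i : nat) == j)%:R).
apply/submxP; exists (\row_k mu (enum_val k)); apply/rowP => j.
rewrite !mxE -val_eqE E; last exact: (ltn_ord j).
rewrite (bigID (mem J)) /= [X in _ + X]big1 ?addr0; last first.
  by move=> k /mu0 ->; rewrite mul0r.
by rewrite big_enum_val; apply: eq_bigr => k _; rewrite !mxE.
Qed.

Lemma repr_subr J y mu al : represents J y mu -> (forall i, i \notin J -> al i = 0) ->
  (forall j, (j <= d)%N -> \sum_i al i * v i j = 0) ->
  forall c k, al k * c = mu k -> represents (J :\ k) y (fun i => mu i - c * al i).
Proof.
move=> [mu0 yE] al0 alE c k ck; split => [i|j lej].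
  rewrite !inE negb_and negbK => /predU1P[->|iJ]; last by rewrite mu0 // al0 // mulr0 subr0.
  by rewrite mulrC ck subrr.
rewrite yE //; under [RHS]eq_bigr do rewrite mulrBl -mulrA.
by rewrite sumrB -mulr_sumr alE // mulr0 subr0.
Qed.

Lemma spanning_remove J al k : spanning J -> (forall i, i \notin J -> al i = 0) ->
  (forall j, (j <= d)%N -> \sum_i al i * v i j = 0) -> al k != 0 -> spanning (J :\ k).
Proof.
move=> sJ al0 alE ak y; have [mu muE] := sJ y.
by exists (fun i => mu i - mu k / al k * al i); apply: repr_subr => //; rewrite mulrC divfK.
Qed.

(** While more than [d + 1] vertices remain they are dependent, and moving along a dependence
    removes one of them without losing nonnegativity or the span. *)
Lemma caratheodory J y mu : spanning J -> represents J y mu -> (forall i, 0 <= mu i) ->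
  exists2 W, basis W & forall i, 0 <= baryc W y i.
Proof.
have [m] := ubnP #|J|; elim: m J mu => // m IH J mu; rewrite ltnS => leJ sJ yE mu0.
have := spanning_card sJ; rewrite leq_eqVlt => /predU1P[cJ|cJ].
  have bJ := spanning_basis sJ (esym cJ).
  by exists J => // i; rewrite (baryc_uniq bJ yE).
have [al [[i1 al1] al0 alE]] := dependent cJ.
have [k [ak c0 muk]] := ratio_test mu0 al1.
have kJ : k \in J by apply: contraTT ak => /al0 ->; rewrite ltxx.
apply: (IH (J :\ k)) (repr_subr yE al0 alE _) muk.
- by apply: leq_trans leJ; rewrite [X in (_ < X)%N](cardsD1 k) kJ.
- by apply: spanning_remove al0 alE _ => //; rewrite gt_eqF.
- by rewrite mulrC divfK // gt_eqF.
Qed.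

Variable om : 'I_n -> F.

(** The linear function that takes the values [om i] at the vertices of [W]. *)
Definition height W y := \sum_i baryc W y i * om i.

(* The lower faces of the lifted points [(v i, om i)]. *)
Definition cells : pred {set 'I_n} :=
  fun W => basis W && [forall i, (i \notin W) ==> (height W (v i) < om i)].

Definition generic_heights :=
  forall W, basis W -> forall i, i \notin W -> height W (v i) != om i.

Definition generic y := forall W, basis W -> forall i, i \in W -> baryc W y i != 0.

Lemma baryc_vertex W i : basis W -> i \in W -> baryc W (v i) =1 (fun k => (k == i)%:R).
Proof.
move=> bW iW; apply: baryc_uniq => //; split => [k|j _].
  by apply: contraNeq; rewrite pnatr_eq0 eqb0 negbK => /eqP ->.
rewrite (bigD1 i) //= eqxx mul1r big1 ?addr0 // => k /negPf ->.
by rewrite mul0r.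
Qed.

Lemma height_vertex W i : basis W -> i \in W -> height W (v i) = om i.
Proof.
move=> bW iW; rewrite /height (bigD1 i) //= baryc_vertex // eqxx mul1r big1 ?addr0 //.
by move=> k /negPf nk; rewrite baryc_vertex // nk mul0r.
Qed.

Lemma height_linear W y mu : basis W -> represents [set: 'I_n]%SET y mu ->
  height W y = \sum_i mu i * height W (v i).
Proof.
move=> bW [_ yE]; rewrite /height.
have E : baryc W y =1 (fun k => \sum_i mu i * baryc W (v i) k).
  apply: baryc_uniq => //; split=> [k kW|j lej].
    by apply: big1 => i _; rewrite baryc_out ?mulr0 //; case/andP: bW => /eqP.
  rewrite yE //; under [RHS]eq_bigr do rewrite mulr_suml.
  rewrite exchange_big; apply: eq_bigr => i _ /=.
  under eq_bigr do rewrite -mulrA.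
  by rewrite -mulr_sumr; congr (_ * _); apply: (baryc_repr (v i) bW).2.
under eq_bigr do rewrite E mulr_suml.
rewrite exchange_big; apply: eq_bigr => i _ /=.
by rewrite mulr_sumr; apply: eq_bigr => k _; rewrite mulrA.
Qed.

Lemma repr_setT J y mu : represents J y mu -> represents [set: 'I_n]%SET y mu.
Proof. by case=> _ H; split => // i; rewrite inE. Qed.

(** The linear function of a cell [U] lies below [om] at all vertices, strictly off [U]. Writing [y]
    positively in [U'] gives [height U y <= height U' y], strictly unless [U'] is contained in [U];
    exchange of the two cells forces equality. *)
Lemma cells_uniq W W' y : W \in cells -> W' \in cells ->
  open_cone (simplex_of W) y -> open_cone (simplex_of W') y -> W = W'.
Proof.
suff H (U U' : {set 'I_n}) : U \in cells -> U' \in cells -> open_cone (simplex_of U) y ->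
    open_cone (simplex_of U') y -> height U y <= height U' y /\
    (~~ (U' \subset U) -> height U y < height U' y).
  move=> cW cW' pW pW'; have [le1 lt1] := H _ _ cW cW' pW pW'.
  have [le2 lt2] := H _ _ cW' cW pW' pW.
  have s1 : W' \subset W by apply: contraLR le2 => /lt1; rewrite -ltNge.
  have s2 : W \subset W' by apply: contraLR le1 => /lt2; rewrite -ltNge.
  by apply/eqP; rewrite finset.eqEsubset s1 s2.
move=> /andP[bU /forallP cU] /andP[bU' _] pU /(open_cone_simp _ bU') pU'.
have leU i : height U (v i) <= om i.
  have [iU|iU] := boolP (i \in U); first by rewrite height_vertex.
  by have := cU i; rewrite iU => /ltW.
have b0 i : 0 <= baryc U' y i.
  have [/pU'/ltW //|iU] := boolP (i \in U').
  by rewrite baryc_out //; case/andP: bU' => /eqP.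
rewrite (height_linear bU (repr_setT (baryc_repr y bU'))).
split; first by apply: ler_sum => i _; rewrite ler_wpM2l.
case/subsetPn => i iU' iU; rewrite [X in _ < X]/height (bigD1 i) //= [X in _ < X](bigD1 i) //=.
rewrite ltr_leD //; last by apply: ler_sum => k _; rewrite ler_wpM2l.
by rewrite ltr_pM2l ?pU' //; have := cU i; rewrite iU.
Qed.

(* An optimal feasible basis of the linear program [min sum mu om] is dual feasible: otherwise a
   pivot would improve it. *)
Lemma cells_exist y : generic_heights -> generic y -> spanning [set: 'I_n]%SET -> incone y ->
  exists2 W, W \in cells & open_cone (simplex_of W) y.
Proof.
move=> gh gy sT [mu mu0 yE].
have [W0 bW0 pW0] := caratheodory sT yE mu0.
pose P W := basis W && [forall i, 0 <= baryc W y i].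
have PW0 : P W0 by rewrite /P bW0; apply/forallP.
have [W /andP[bW /forallP pW] Wmin] := @arg_minP _ _ _ W0 P (height ^~ y) PW0.
have cW : #|W| = d.+1 by case/andP: bW => /eqP.
have posW i : i \in W -> 0 < baryc W y i by move=> iW; rewrite lt_neqAle eq_sym gy // pW.
exists W; last by apply/(open_cone_simp _ bW).
rewrite unfold_in bW; apply/forallP => i; apply/implyP => iW.
rewrite lt_neqAle gh //= leNgt; apply/negP => lt_om.
(* The dependence between [v i] and the vertices of [W]; moving along [- al] brings [i] into the
   basis. *)
pose al k := baryc W (v i) k - (k == i)%:R.
have al_sum (g : 'I_n -> F) : \sum_k al k * g k = \sum_k baryc W (v i) k * g k - g i.
  under eq_bigr do rewrite mulrBl.
  rewrite sumrB; congr (_ - _); rewrite (bigD1 i) //= eqxx mul1r big1 ?addr0 //.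
  by move=> k /negPf ->; rewrite mul0r.
have alE j : (j <= d)%N -> \sum_k al k * v k j = 0.
  by move=> lej; rewrite al_sum -(baryc_repr (v i) bW).2 // subrr.
have al_out k : k \notin i |: W -> al k = 0.
  by rewrite !inE negb_or => /andP[/negPf nki kW]; rewrite /al nki baryc_out // subrr.
have ali : al i = - 1 by rewrite /al eqxx baryc_out // sub0r.
(* The coordinates of [v i] sum to its weight [1], so one of them is positive. *)
have [k0 alk0] : exists k, 0 < al k.
  apply/existsP; apply: contraTT isT; rewrite negb_exists => /forallP H.
  have : \sum_k baryc W (v i) k <= 0.
    apply: sumr_le0 => k _; have [kW|kW] := boolP (k \in W); last by rewrite baryc_out.
    have := H k; rewrite -leNgt /al; case: eqP => [ki|_]; last by rewrite subr0.
    by move: iW; rewrite -ki kW.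
  have := (baryc_repr (v i) bW).2 0%N isT; rewrite v0.
  under eq_bigr do rewrite v0 mulr1.
  by move=> <-; rewrite ler10.
have [k [ak c0 muk]] := ratio_test pW alk0.
have kW : k \in W.
  apply: contraTT ak => kW; rewrite /al baryc_out // sub0r oppr_gt0 -leNgt.
  by rewrite ler0n.
have kJ : k \in i |: W by rewrite !inE kW orbT.
have repW : represents (i |: W) y (baryc W y).
  split; last exact: (baryc_repr y bW).2.
  by move=> l; rewrite !inE negb_or => /andP[_ lW]; rewrite baryc_out.
have sJ : spanning ((i |: W) :\ k).
  apply: (spanning_remove _ al_out alE); last by rewrite gt_eqF.
  move=> x; exists (baryc W x); split; last exact: (baryc_repr x bW).2.
  by move=> l; rewrite !inE negb_or => /andP[_ lW]; rewrite baryc_out.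
have := repr_subr repW al_out alE; move=> /(_ (baryc W y k / al k) k).
rewrite mulrC divfK ?gt_eqF // => /(_ erefl) repJ.
have bJ : basis ((i |: W) :\ k).
  apply: (spanning_basis sJ); apply/eqP; rewrite -eqSS.
  have := cardsD1 k (i |: W); rewrite kJ cardsU1 iW cW add1n add1n => E.
  by rewrite -E.
have PJ : P ((i |: W) :\ k).
  by rewrite /P bJ; apply/forallP => l; rewrite (baryc_uniq bJ repJ).
(* The pivot lowers the objective by the step times [height W (v i) - om i]. Genericity of [y] makes
   the step positive, which contradicts minimality. *)
have := Wmin _ PJ; apply/negP; rewrite -ltNge /height.
under eq_bigr do rewrite (baryc_uniq bJ repJ) /= mulrBl -[X in _ - X]mulrA.
rewrite sumrB -mulr_sumr al_sum ltrBlDr ltrDl mulr_gt0 //.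
  by rewrite divr_gt0 // posW.
by rewrite subr_gt0.
Qed.

End Triangulation.
Arguments simplex_of {F} d {n} v i0 W _ _.

(** * From simplices to polytopes through a triangulation *)

Section PolytopeCount.
Variables (F : archiRealFieldType) (d n : nat) (v : 'I_n -> nat -> F) (i0 : 'I_n).
Hypothesis v0 : forall i, v i 0%N = 1.
Local Notation basis := (basis d v i0).
Local Notation baryc := (baryc d v i0).

(** Heights [x ^+ i] work: each forbidden coincidence is a polynomial equation in [x] whose
    coefficient of degree [i] is [-1], because [i] is not in [W], and finitely many nonzero
    polynomials have a common non-root. *)
Lemma generic_heights_exist : exists om, generic_heights d v i0 om.
Proof.
pose p W i : {poly F} := \sum_k baryc W (v i) k *: 'X^k - 'X^i.
pose P := \prod_(W | basis W) \prod_(i | i \notin W) p W i.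
have [|x xP] := @exists_nonroot F P.
  apply/prodf_neq0 => W bW; apply/prodf_neq0 => i iW.
  apply/eqP => /(congr1 (fun q : {poly F} => q`_i)); rewrite coef0 coefB coefXn eqxx.
  rewrite coef_sum big1 => [|k _]; first by rewrite sub0r => /eqP; rewrite oppr_eq0 oner_eq0.
  rewrite coefZ coefXn; case: eqP => [/val_inj <-|_]; last by rewrite mulr0.
  by rewrite baryc_out ?mul0r //; case/andP: bW => /eqP.
exists (fun i => x ^+ i) => W bW i iW.
move: xP; rewrite horner_prod => /prodf_neq0/(_ W bW); rewrite horner_prod => /prodf_neq0/(_ i iW).
rewrite hornerD hornerN hornerXn subr_eq0 horner_sum; apply: contra => /eqP <-.
by apply/eqP; apply: eq_bigr => k _; rewrite hornerZ hornerXn.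
Qed.

Hypothesis spanT : spanning d v [set: 'I_n]%SET.

Lemma incone_cells om y : generic_heights d v i0 om -> generic d v i0 y ->
  `[< incone d v y >]%:R = \sum_(W in cells d v i0 om) (open_cone (simplex_of d v i0 W) y)%:R :> F.
Proof.
move=> gh gy; case: asboolP => [iy|niy].
  have [W cW pW] := cells_exist v0 gh gy spanT iy.
  rewrite (bigD1 W) //= pW big1 ?addr0 // => W' /andP[cW' nWW'].
  rewrite (_ : open_cone _ _ = false) //; apply/negbTE/negP => pW'.
  by move/eqP: nWW'; apply; apply: (cells_uniq cW' cW pW' pW).
rewrite big1 // => W /andP[bW _].
rewrite (_ : open_cone _ _ = false) //; apply/negbTE/negP => /(open_cone_simp _ bW) pW; apply: niy.
exists (baryc W y); last exact: repr_setT (baryc_repr y bW).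
move=> i; have [/pW/ltW //|iW] := boolP (i \in W).
by rewrite baryc_out //; case/andP: bW => /eqP.
Qed.

End PolytopeCount.

Section LatticePolytopeCount.
Variables (F : archiRealFieldType) (d n : nat) (v : 'I_n -> nat -> F).
Hypothesis v0 : forall i, v i 0%N = 1.
Hypothesis fv : flag_integral d.+1 v.
Hypothesis spanT : spanning d.+1 v [set: 'I_n]%SET.

Lemma flag_integral_simp (i0 : 'I_n) (W : {set 'I_n}) : #|W| = d.+2 ->
    flag_integral d.+1 (simplex_of d.+1 v i0 W).
Proof. by move=> cW; exact: (flag_integral_comp (nth_enum_inj (i0 := i0) cW) fv). Qed.

Lemma generic_low_point (i0 : 'I_n) (s : F) (N : int) c z : 0 < s < 1 ->
  generic d.+1 v i0 (low_point s d.+1 N%:~R c z).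
Proof.
move=> s01 W /andP[/eqP cW uW] i iW; have [k ->] := nth_enum_surj i0 cW iW.
rewrite baryc_nth //; apply: bary_low_point_neq0 => // [j|]; first exact: v0.
exact: flag_integral_simp.
Qed.

Lemma spanning_point : inhabited 'I_n.
Proof.
have := spanning_card spanT; rewrite cardsT card_ord; case: n => // m _.
by constructor; exact: ord0.
Qed.

Theorem count_lattice_polytope (s : F) : 0 < s < 1 -> exists K : F, forall (N : int) c, 0 < N ->
  evsum d.+1 (fun z => `[< incone d.+1 v (low_point s d.+1 N%:~R c z) >]%:R)
    (N%:~R ^+ d.+1 * K).
Proof.
move=> s01; have [i0] := spanning_point.
have [om gh] := generic_heights_exist d.+1 v i0.
exists (\sum_(W in cells d.+1 v i0 om) `|\det (homog_mx (simplex_of d.+1 v i0 W))| / d.+1`!%:R).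
move=> N c N0; rewrite mulr_sumr.
apply: (@eq_evsum _ _ (fun z => \sum_(W in cells d.+1 v i0 om)
  (open_cone (simplex_of d.+1 v i0 W) (low_point s d.+1 N%:~R c z))%:R)) => [z _|].
  by symmetry; apply: (incone_cells v0 spanT gh); apply: generic_low_point.
apply: evsum_sum => W _ /andP[/andP[/eqP cW uW] _]; rewrite mulrA.
apply: count_simplex => //.
- by move=> k; apply: v0.
- exact: flag_integral_simp.
- by rewrite ltr0z.
Qed.

(** Take a simplex containing the point lowered by [s]. Its coordinates are affine in the shift, and
    one that became negative at [t] would vanish at a shift strictly between [0] and [1], against
    [generic_low_point]. The endpoints [t = 0] and [t = 1] are allowed. *)
Lemma low_point_line (N : int) c z (s t : F) : 0 < s < 1 -> 0 <= t <= 1 ->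
  incone d.+1 v (low_point s d.+1 N%:~R c z) -> incone d.+1 v (low_point t d.+1 N%:~R c z).
Proof.
move=> s01 t01 [mu mu0 yE]; have [i0] := spanning_point.
have [W bW pW] := caratheodory i0 spanT yE mu0.
have cW : #|W| = d.+2 by case/andP: bW => /eqP.
pose y r : nat -> F := low_point r d.+1 N%:~R c z.
pose b r i := baryc d.+1 v i0 W (y r) i.
have bE r r' th i : b ((1 - th) * r + th * r') i = (1 - th) * b r i + th * b r' i.
  rewrite /b; apply: (baryc_uniq (mu := fun i => (1 - th) * b r i + th * b r' i)) => //.
  split=> [k kW|j lej]; first by rewrite /b !baryc_out // !mulr0 addr0.
  under eq_bigr do rewrite mulrDl -!mulrA.
  rewrite big_split /= -!mulr_sumr /b -(baryc_repr (y r) bW).2 // -(baryc_repr (y r') bW).2 //.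
  rewrite /y /low_point; case: j lej => [|j] _; first by ring.
  by rewrite /last_shift; case: ifP => _; ring.
exists (b t); last exact: repr_setT (baryc_repr (y t) bW).
move=> i; rewrite leNgt; apply/negP => bt_lt0.
have iW : i \in W by apply: contraTT bt_lt0 => iW; rewrite /b baryc_out // ltxx.
have bs_gt0 : 0 < b s i.
  by rewrite lt_neqAle pW andbT eq_sym; exact: (generic_low_point N c z s01 bW iW).
have dif : 0 < b s i - b t i by lra.
(* The parameter at which the coordinate, affine from [s] to [t], is zero. *)
pose th := b s i / (b s i - b t i).
have th01 : 0 < th < 1 by rewrite divr_gt0 //= ltr_pdivrMr // mul1r ltrDl oppr_gt0.
have r01 : 0 < (1 - th) * s + th * t < 1.
  move: s01 t01 th01 => /andP[? ?] /andP[? ?] /andP[? ?]; apply/andP; split; nra.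
have := generic_low_point N c z r01 bW iW; rewrite -/(y _) -/(b _ _) bE => /eqP; apply.
by rewrite /th; field; rewrite gt_eqF.
Qed.

End LatticePolytopeCount.

(** * Lattice-face polytopes *)

Section Convexity.
Variable R : realType.

Definition homog k (x : 'rV[R]_k) : nat -> R :=
  fun j => if j is j'.+1 then (if insub j' is Some i then x 0 i else 0) else 1.

Lemma homogS k (x : 'rV[R]_k) (i : 'I_k) : homog x i.+1 = x 0 i.
Proof. by rewrite /homog valK. Qed.

Lemma homog_inj k (x y : 'rV[R]_k) : (forall j, (j <= k)%N -> homog x j = homog y j) -> x = y.
Proof. by move=> xy; apply/rowP => i; rewrite -!homogS xy. Qed.

Lemma homog_sum k n (w : 'I_n -> R) (p : 'I_n -> 'rV[R]_k) : \sum_i w i = 1 ->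
  forall j, homog (\sum_i w i *: p i) j = \sum_i w i * homog (p i) j.
Proof.
move=> w1 [|j] /=; first by rewrite -[LHS]w1; apply: eq_bigr => i _; rewrite mulr1.
case: insubP => [i _ _|_]; last by rewrite big1 // => i _; rewrite mulr0.
by rewrite summxE; apply: eq_bigr => l _; rewrite mxE.
Qed.

Lemma homog_proj k (x : 'rV[R]_k.+1) j : (j <= k)%N -> homog (proj x) j = homog x j.
Proof.
case: j => // j ltj; rewrite (homogS (proj x) (Ordinal ltj)) mxE.
by rewrite -(homogS x (widen_ord (leqnSn k) (Ordinal ltj))).
Qed.

(** [conv] and [aff] allow lists of any length with repetitions; adding the weights of equal points
    gives one weight per entry of [V]. *)
Lemma comb_regroup k (V pts : seq 'rV[R]_k) (w : seq R) n :
  size V = n -> {subset pts <= V} -> size w = size pts -> exists mu : 'I_n -> R,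
  [/\ (forall c, c \in w -> 0 <= c) -> forall i, 0 <= mu i, \sum_i mu i = \sum_(c <- w) c &
    \sum_i mu i *: V`_i = \sum_(l < size pts) w`_l *: pts`_l].
Proof.
move=> sV ptsV sw.
pose mu (i : 'I_n) := \sum_(l < size pts | index pts`_l V == i) w`_l.
have idx (l : 'I_(size pts)) : (index (nth 0%R pts l) V < n)%N.
  by rewrite -sV index_mem; apply/ptsV/mem_nth.
exists mu; split.
- by move=> w0 i; apply: sumr_ge0 => l _; apply/w0/mem_nth; rewrite sw.
- rewrite [RHS](big_nth 0) big_mkord sw [RHS](partition_big (fun l => Ordinal (idx l)) xpredT) //=.
- rewrite [RHS](partition_big (fun l => Ordinal (idx l)) xpredT) //=.
  apply: eq_bigr => i _; rewrite scaler_suml; apply: eq_big => [l|l /eqP <-].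
    by rewrite -val_eqE.
  by rewrite nth_index //; apply/ptsV/mem_nth.
Qed.

Lemma aff_comb k (V : seq 'rV[R]_k) n x : size V = n -> aff [set` V] x ->
  exists2 mu : 'I_n -> R, \sum_i mu i = 1 & x = \sum_i mu i *: V`_i.
Proof.
move=> sV [pts [w [sw ptsV w1 xE]]].
have [mu [_ mu1 muE]] := comb_regroup sV ptsV sw.
by exists mu; rewrite ?mu1 ?muE.
Qed.

Lemma convP k (V : seq 'rV[R]_k) n x : size V = n -> conv [set` V] x <->
  exists mu : 'I_n -> R,
    [/\ forall i, 0 <= mu i, \sum_i mu i = 1 & x = \sum_i mu i *: V`_i].
Proof.
move=> sV; split=> [[pts [w [sw ptsV w0 w1 xE]]]|[mu [mu0 mu1 xE]]].
  have [mu [mu_ge0 mu1 muE]] := comb_regroup sV ptsV sw.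
  by exists mu; split; rewrite ?mu1 ?muE //; apply: mu_ge0.
exists V, [seq mu i | i <- enum 'I_n]; split.
- by rewrite size_map size_enum_ord.
- by [].
- by move=> c /mapP[i _ ->].
- by rewrite big_map big_enum.
- rewrite xE sV; apply: eq_bigr => i _; congr (_ *: _).
  by rewrite (nth_map i) ?size_enum_ord // nth_ord_enum.
Qed.

Definition homog_family k n (V : seq 'rV[R]_k) : 'I_n -> nat -> R := fun i => homog V`_i.

Lemma conv_incone k n (V : seq 'rV[R]_k) x : size V = n ->
  conv [set` V] x <-> incone k (homog_family (n := n) V) (homog x).
Proof.
move=> sV; rewrite (convP _ sV); split => [[mu [mu0 mu1 ->]]|[mu mu0 [_ xE]]].
  exists mu => //; split => [i|j _]; first by rewrite inE.
  exact: homog_sum.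
have mu1 : \sum_i mu i = 1.
  have := xE 0%N isT; rewrite /= => ->; apply: eq_bigr => i _; rewrite mulr1 //.
exists mu; split => //; apply: homog_inj => j lej.
by rewrite xE // homog_sum.
Qed.

Lemma conv_mem k (V : seq 'rV[R]_k) v : v \in V -> conv [set` V] v.
Proof.
move=> vV; exists [:: v], [:: 1]; split => //=.
- by move=> p; rewrite inE => /eqP ->.
- by move=> c; rewrite inE => /eqP ->.
- by rewrite big_seq1.
- by rewrite big_ord1 scale1r.
Qed.

Lemma conv_sub k (V V' : seq 'rV[R]_k) : (forall v, v \in V -> conv [set` V'] v) ->
  conv [set` V] `<=` conv [set` V'].
Proof.
move=> VV' x /(convP _ erefl) [mu [mu0 mu1 xE]]; apply/(convP _ erefl).
have /choice[nu nuP] : forall i : 'I_(size V), exists nu : 'I_(size V') -> R,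
    [/\ forall i, 0 <= nu i, \sum_i nu i = 1 & V`_i = \sum_i nu i *: V'`_i].
  by move=> i; apply/(convP _ erefl)/VV'/mem_nth.
exists (fun j => \sum_i mu i * nu i j); split.
- by move=> j; apply: sumr_ge0 => i _; rewrite mulr_ge0 //; case: (nuP i).
- rewrite exchange_big /= -mu1; apply: eq_bigr => i _.
  by rewrite -mulr_sumr; case: (nuP i) => _ -> _; rewrite mulr1.
- under [RHS]eq_bigr do rewrite scaler_suml.
  rewrite exchange_big xE /=; apply: eq_bigr => i _.
  case: (nuP i) => _ _ ->; rewrite scaler_sumr.
  by apply: eq_bigr => j _; rewrite scalerA.
Qed.

Lemma proj_conv k (U : seq 'rV[R]_k.+1) :
  proj @` conv [set` U] = conv [set` [seq proj x | x <- U]].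
Proof.
have projs n (mu : 'I_n -> R) : proj (\sum_i mu i *: U`_i) = \sum_i mu i *: proj U`_i.
  apply/rowP => l; rewrite mxE !summxE; apply: eq_bigr => i _.
  by rewrite !mxE.
have sm : size [seq proj x | x <- U] = size U by rewrite size_map.
apply/seteqP; split => [_ [x /(convP _ erefl)[mu [mu0 mu1 ->]] <-]|x /(convP _ sm)].
  apply/(convP _ sm); exists mu; split=> //; rewrite projs.
  by apply: eq_bigr => i _; rewrite (nth_map 0).
move=> [mu [mu0 mu1 ->]]; exists (\sum_i mu i *: U`_i); first by apply/(convP _ erefl); exists mu.
by rewrite projs; apply: eq_bigr => i _; rewrite (nth_map 0).
Qed.

(** Generators are discarded until all are vertices. A non-vertex [v] is a proper combination of two
    points of the hull; its own weight there is less than [1], so it can be solved for in terms of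
    the other generators. *)
Lemma polytope_vertices k (P : set 'rV[R]_k) : polytope P ->
  exists V : seq 'rV[R]_k, [/\ uniq V, P = conv [set` V] & forall v, v \in V -> vertex P v].
Proof.
move=> [V0 ->]; have [m] := ubnP (size V0); elim: m V0 => // m IH V0; rewrite ltnS => sV0.
have [uV0|nuV0] := boolP (uniq V0); last first.
  have -> : conv [set` V0] = conv [set` undup V0].
    by apply/seteqP; split; apply: conv_sub => v; rewrite ?mem_undup => vV; apply: conv_mem;
        rewrite ?mem_undup.
  by apply: IH; rewrite (leq_trans _ sV0) // ltn_size_undup.
have [allv|/existsNP[v /not_implyP[vV nv]]] :=
    pselect (forall v, v \in V0 -> vertex (conv [set` V0]) v).
  by exists V0.
pose V1 := [seq u <- V0 | u != v].
suff cE : conv [set` V0] = conv [set` V1].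
  rewrite cE; apply: IH; apply: leq_trans sV0.
  rewrite size_filter -(count_predC (fun u => u != v)) -addn1 leq_add2l -has_count.
  by apply/hasP; exists v => //=; rewrite eqxx.
apply/seteqP; split; last first.
  by apply: conv_sub => u; rewrite mem_filter => /andP[_ uV]; apply: conv_mem.
apply: conv_sub => u uV; have [->|nuv] := eqVneq u v; last first.
  by apply: conv_mem; rewrite mem_filter nuv.
have /not_andP[//|/existsNP[x /existsNP[y /existsNP[t]]]] := nv.
  by move=> /(_ (conv_mem vV)).
move=> /not_implyP[/(convP _ erefl)[la [la0 la1 xE]]].
move=> /not_implyP[/(convP _ erefl)[lb [lb0 lb1 yE]]].
move=> /not_implyP[t01 /not_implyP[vE nxy]]; have /andP[t_gt0 t_lt1] := t01.
have iV : (index v V0 < size V0)%N by rewrite index_mem.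
pose i := Ordinal iV; have Vi : V0`_i = v by apply: nth_index.
have one (l : 'I_(size V0) -> R) : (forall j, 0 <= l j) -> \sum_j l j = 1 -> l i = 1 ->
    \sum_j l j *: V0`_j = v.
  move=> l0 l1 li; rewrite (bigD1 i) //= li scale1r Vi big1 ?addr0 // => j nji.
  have : \sum_(j | j != i) l j = 0.
    by have := l1; rewrite (bigD1 i) //= li => /(canRL (addKr _)) ->; rewrite addNr.
  move/eqP; rewrite psumr_eq0 // => /allP/(_ j); rewrite mem_index_enum nji => /(_ isT)/eqP ->.
  by rewrite scale0r.
have le1 (l : 'I_(size V0) -> R) : (forall j, 0 <= l j) -> \sum_j l j = 1 -> l i <= 1.
  by move=> l0 <-; rewrite (bigD1 i) //= lerDl sumr_ge0.
pose al j := (1 - t) * la j + t * lb j.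
have al0 j : 0 <= al j by apply: addr_ge0; apply: mulr_ge0 => //; rewrite ?subr_ge0 ltW.
have al1 : \sum_j al j = 1 by rewrite big_split /= -!mulr_sumr la1 lb1; ring.
have vE' : v = \sum_j al j *: V0`_j.
  rewrite vE xE yE !scaler_sumr -big_split /=.
  by apply: eq_bigr => j _; rewrite /al [RHS]scalerDl !scalerA.
(* Weight [1] would force both [x] and [y] to be [v]. *)
have ali : al i < 1.
  rewrite lt_neqAle le1 // andbT; apply/eqP => ali.
  have := le1 _ la0 la1; have := le1 _ lb0 lb1 => lbi lai; apply: nxy.
  have lai1 : la i = 1 by move: ali; rewrite /al => ali; nra.
  have lbi1 : lb i = 1 by move: ali; rewrite /al lai1 => ali; nra.
  by rewrite xE yE !one.
have d0 : 1 - al i != 0 by rewrite subr_eq0 eq_sym lt_eqF.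
pose be j := if j == i then 0 else al j / (1 - al i).
have vE2 : v = \sum_j be j *: V0`_j.
  have : (1 - al i) *: v = (1 - al i) *: \sum_j be j *: V0`_j.
    rewrite scalerBl scale1r {1}vE' (bigD1 i) //= Vi addrAC subrr add0r scaler_sumr.
    rewrite [RHS](bigD1 i) //= /be eqxx scale0r scaler0 add0r.
    by apply: eq_bigr => j /negPf ->; rewrite scalerA mulrC divfK.
  by move/(scalerI d0).
have be0 j : 0 <= be j by rewrite /be; case: ifP => // _; rewrite divr_ge0 // subr_ge0 ltW.
have be1 : \sum_j be j = 1.
  rewrite (bigD1 i) //= /be eqxx add0r (eq_bigr (fun j => al j / (1 - al i))).
    rewrite -mulr_suml; have := al1; rewrite (bigD1 i) //= => /(canRL (addKr _)) ->.
    by rewrite addrC divff.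
  by move=> j /negPf ->.
exists [seq V0`_(val j) | j <- enum 'I_(size V0) & j != i],
  [seq be j | j <- enum 'I_(size V0) & j != i]; split.
- by rewrite !size_map.
- move=> p /mapP[j]; rewrite mem_filter => /andP[nji _] ->; rewrite /= mem_filter mem_nth // andbT.
  by rewrite -Vi nth_uniq.
- by move=> c /mapP[j _ ->].
- rewrite big_map big_filter big_enum_cond /= -[RHS]be1 [RHS](bigD1 i) //=.
  by rewrite [be i]/be eqxx add0r.
- rewrite size_map {1}vE2 (bigD1 i) //= [be i]/be eqxx scale0r add0r.
  transitivity (\sum_(j <- [seq j <- enum 'I_(size V0) | j != i]) be j *: V0`_j).
    by rewrite big_filter big_enum_cond.
  rewrite (big_nth i) big_mkord.
  by apply: eq_bigr => j _; rewrite !(nth_map i).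
Qed.

End Convexity.

(** * The recursive definition unfolded on the vertices *)

Section LatticeFaces.
Variable R : realType.

Lemma fulldim_spanning k n (V : seq 'rV[R]_k) : size V = n -> fulldim (conv [set` V]) ->
  spanning k (homog_family (n := n) V) [set: 'I_n]%SET.
Proof.
move=> sV full.
have span_homog (x : 'rV[R]_k) : exists mu, represents k (homog_family (n :=
    n) V) [set: 'I_n]%SET (homog x) mu.
  have : aff (conv [set` V]) x by rewrite full.
  move=> [pts [w [sw ptsV w1 xE]]].
  have /choice[nu nuP] : forall i : 'I_(size pts), exists nu : 'I_n -> R,
      [/\ forall i, 0 <= nu i, \sum_i nu i = 1 & pts`_i = \sum_i nu i *: V`_i].
    by move=> i; apply/(convP _ sV)/ptsV/mem_nth.
  exists (fun j => \sum_(i < size pts) w`_i * nu i j); split=> [i|j _]; first by rewrite inE.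
  have w1' : \sum_(i < size pts) w`_i = 1 by rewrite -[RHS]w1 [RHS](big_nth 0) big_mkord sw.
  rewrite xE homog_sum //; under [RHS]eq_bigr do rewrite mulr_suml.
  rewrite exchange_big /=; apply: eq_bigr => i _.
  case: (nuP i) => _ nu1 ->; rewrite homog_sum // mulr_sumr.
  by apply: eq_bigr => l _; rewrite mulrA.
(* A vector of weight [y 0] is the weight-one point with the same coordinates plus [y 0 - 1] times
   the origin. *)
move=> y; have [mu [_ muE]] := span_homog (\row_i y (i : nat).+1).
have [nu [_ nuE]] := span_homog 0.
exists (fun i => mu i + (y 0%N - 1) * nu i); split=> [i|j lej]; first by rewrite inE.
under eq_bigr do rewrite mulrDl -mulrA.
rewrite big_split -mulr_sumr -muE // -nuE //; case: j lej => [|j] ltj /=; first by ring.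
by rewrite insubT !mxE /=; ring.
Qed.

Lemma unit_rows_inj k (w : 'I_k.+1 -> nat -> R) : homog_mx w \in unitmx ->
  forall mu nu : 'I_k.+1 -> R,
  (forall j, (j <= k)%N -> \sum_i mu i * w i j = \sum_i nu i * w i j) -> mu =1 nu.
Proof.
move=> wu mu nu E i.
rewrite -(bary_uniq (y := fun j => \sum_i mu i * w i j) wu (lam := mu)) //.
exact: bary_uniq.
Qed.

Lemma simplex_unit k (U : seq 'rV[R]_k) : size U = k.+1 -> fulldim (conv [set` U]) ->
  homog_mx (homog_family (n := k.+1) U) \in unitmx.
Proof.
move=> sU full; have sp := fulldim_spanning sU full.
rewrite -row_full_unit -sub1mx; apply/row_subP => i.
have [mu [_ E]] := sp (fun j => ((i : nat) == j)%:R).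
apply/submxP; exists (\row_k mu k); apply/rowP => j.
rewrite !mxE -val_eqE E; last exact: (ltn_ord j).
by apply: eq_bigr => l _; rewrite !mxE.
Qed.

Lemma simplex_vertex k (U : seq 'rV[R]_k) (i : 'I_k.+1) : size U = k.+1 ->
  homog_mx (homog_family (n := k.+1) U) \in unitmx -> vertex (conv [set` U]) U`_i.
Proof.
move=> sU uU; split; first by apply: conv_mem; rewrite mem_nth // sU.
move=> x y t /(convP _ sU)[la [la0 la1 xE]] /(convP _ sU)[lb [lb0 lb1 yE]] t01 E.
have /andP[t_gt0 t_lt1] := t01.
pose al j := (1 - t) * la j + t * lb j.
have al1 : \sum_j al j = 1 by rewrite big_split /= -!mulr_sumr la1 lb1; ring.
have alE j : al j = (j == i)%:R.
  apply: (unit_rows_inj uU (nu := fun j => (j == i)%:R)) => l lel;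
      rewrite /homog_family -homog_sum //.
  rewrite [RHS](bigD1 i) //= eqxx mul1r [X in _ + X]big1 ?addr0 => [|m /negPf ->];
      last by rewrite mul0r.
  congr (homog _ _); rewrite E xE yE !scaler_sumr -big_split /=.
  by apply: eq_bigr => m _; rewrite /al [LHS]scalerDl !scalerA.
have la_i j : j != i -> la j = 0 /\ lb j = 0.
  move=> /negPf nji; have := alE j; rewrite nji /al /=.
  have := la0 j; have := lb0 j => ? ?.
  have : 0 <= (1 - t) * la j by rewrite mulr_ge0 // subr_ge0 ltW.
  have : 0 <= t * lb j by rewrite mulr_ge0 // ltW.
  move=> h1 h2 h3; have e1 : t * lb j = 0 by lra.
  have e2 : (1 - t) * la j = 0 by lra.
  move/eqP: e1; move/eqP: e2; rewrite !mulf_eq0 (gt_eqF t_gt0) subr_eq0 (gt_eqF t_lt1) /=.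
  by move=> /eqP -> /eqP ->.
have one (l : 'I_k.+1 -> R) : \sum_j l j = 1 -> (forall j, j != i -> l j = 0) ->
    \sum_j l j *: U`_j = U`_i.
  move=> l1 l0; rewrite (bigD1 i) //= big1 => [|j /l0 ->]; last by rewrite scale0r.
  move: l1; rewrite (bigD1 i) //= big1 => [|j /l0 -> //].
  by rewrite !addr0 => ->; rewrite scale1r.
by rewrite xE yE !one // => j /la_i[].
Qed.

Lemma latticeFace_fulldim k (P : set 'rV[R]_k.+1) : latticeFace P -> fulldim P.
Proof.
case: k P => [|k] P; last by case.
move=> [a [b [_ _ ltab ->]]]; apply/seteqP; split => // x _.
have d0 : b - a != 0 by rewrite subr_eq0 gt_eqF.
pose s := (x 0 0 - a) / (b - a).
exists [:: const_mx a; const_mx b], [:: 1 - s; s]; split => //.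
- move=> p; rewrite !inE => /orP[] /eqP -> /=; rewrite mxE lexx ?andbT ltW //.
- by rewrite !big_cons big_nil addr0 subrK.
- rewrite !big_ord_recl big_ord0 /= addr0; apply/rowP => i; rewrite (ord1 i) !mxE /s.
  by field.
Qed.

Lemma latticeFace_polytope k (P : set 'rV[R]_k.+1) : latticeFace P -> polytope P.
Proof.
case: k P => [|k] P; last by case.
move=> [a [b [_ _ ltab ->]]].
have d0 : b - a != 0 by rewrite subr_eq0 gt_eqF.
exists [:: const_mx a; const_mx b]; apply/seteqP; split => x.
  move=> /= /andP[ax xb]; pose s := (x 0 0 - a) / (b - a).
  have s0 : 0 <= s by rewrite divr_ge0 // subr_ge0 // ltW.
  have s1 : s <= 1 by rewrite ler_pdivrMr ?subr_gt0 // mul1r lerD2r.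
  exists [:: const_mx a; const_mx b], [:: 1 - s; s]; split => //.
  - by move=> c; rewrite !inE => /orP[] /eqP ->; rewrite ?subr_ge0.
  - by rewrite !big_cons big_nil addr0 subrK.
  - rewrite !big_ord_recl big_ord0 /= addr0; apply/rowP => i; rewrite (ord1 i) !mxE /s.
    by field.
have s2 : size [:: const_mx a; const_mx b : 'rV[R]_1] = 2%N by [].
move=> /(convP _ s2)[mu [mu0]].
rewrite !big_ord_recl !big_ord0 /= !addr0 => mu1 ->; rewrite !mxE.
have := mu0 0; have := mu0 (lift ord0 ord0); move: mu1.
set m := mu _; set m' := mu _ => ? ? ?.
by apply/andP; split; nra.
Qed.

(* The real coefficients of the affine function are read off at the origin and the unit vectors. *)
Lemma integral_hyperplane k (u : 'I_k.+1 -> 'rV[R]_k.+1) :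
  homog_mx (fun i => homog (u i)) \in unitmx ->
  proj @` (aff [set` codom u] `&` @Zpts R k.+1) = @Zpts R k ->
  exists c : nat -> int, forall i,
    homog (u i) k.+1 = \sum_(j < k.+1) (c j)%:~R * homog (u i) j.
Proof.
move=> uu projZ.
pose g : 'cV[R]_k.+1 := invmx (homog_mx (fun i => homog (u i))) *m \col_i homog (u i) k.+1.
have gE i : homog (u i) k.+1 = \sum_j g j 0 * homog (u i) j.
  have /colP/(_ i) := mulKVmx uu (\col_i homog (u i) k.+1); rewrite -/g !mxE => <-.
  by apply: eq_bigr => j _; rewrite [homog_mx _ _ _]mxE mulrC.
have affE x : aff [set` codom u] x -> homog x k.+1 = \sum_j g j 0 * homog x j.
  have sc : size (codom u) = k.+1 by rewrite size_codom card_ord.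
  move=> /(aff_comb sc)[mu mu1 ->].
  have nE (i : 'I_k.+1) : (codom u)`_i = u i.
    by rewrite codomE (nth_map i) ?size_enum_ord // nth_ord_enum.
  have -> : \sum_(i < k.+1) mu i *: (codom u)`_i = \sum_(i < k.+1) mu i *: u i.
    by apply: eq_bigr => i _; rewrite nE.
  rewrite homog_sum //; under [RHS]eq_bigr do rewrite homog_sum // mulr_sumr.
  rewrite exchange_big; apply: eq_bigr => i _; cbv beta.
  by rewrite gE mulr_sumr; apply: eq_bigr => j _; rewrite mulrCA.
have int_at (y : 'rV[R]_k) : @Zpts R k y -> \sum_(j < k.+1) g j 0 * homog y j \is a Num.int.
  rewrite -projZ => -[x [ax Zx] <-].
  have -> : \sum_(j < k.+1) g j 0 * homog (proj x) j = homog x k.+1.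
    rewrite affE //; apply: eq_bigr => j _; rewrite homog_proj //; exact: (ltn_ord j).
  rewrite (homogS x ord_max); have [m ->] := Zx ord_max; exact: intr_int.
have g0 : g 0 0 \is a Num.int.
  have /int_at : @Zpts R k 0 by move=> i; exists 0; rewrite mxE.
  rewrite big_ord_recl mulr1 big1 ?addr0 // => j _.
  by rewrite lift0 homogS [X in _ * X]mxE mulr0.
have gS (i : 'I_k) : g (lift 0 i) 0 \is a Num.int.
  have /int_at : @Zpts R k (delta_mx 0 i).
    by move=> j; exists (j == i)%:Z; rewrite mxE.
  rewrite big_ord_recl mulr1 (bigD1 i) // lift0 homogS [X in _ * X]mxE !eqxx mulr1 big1 ?addr0;
      last first.
    by move=> j /negPf nji; rewrite lift0 homogS [X in _ * X]mxE nji andbF mulr0.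
  move=> /=; rewrite addr0 => h; rewrite -[g (lift 0 i) 0](addKr (g 0 0)) rpredD ?rpredN //;
      exact: g0.
have gint j : g j 0 \is a Num.int by case: (unliftP 0 j) => [j' ->|->].
exists (fun j => Num.floor (g (inord j) 0)) => i; rewrite gE; apply: eq_bigr => j _.
by rewrite inord_val floorK.
Qed.

Lemma interval_vertex (a b : R) (x : 'rV[R]_1) : a < b ->
  vertex [set x : 'rV[R]_1 | a <= x 0 ord0 <= b] x -> x 0 0 = a \/ x 0 0 = b.
Proof.
move=> ltab [/= /andP[ax xb] ext_x].
move: ax xb; rewrite !le_eqVlt => /predU1P[->|ax]; first by left.
move=> /predU1P[->|xb]; first by right.
have d0 : b - a != 0 by rewrite subr_eq0 gt_eqF.
have [||||/rowP/(_ 0)] := ext_x (const_mx a) (const_mx b) ((x 0 0 - a) / (b - a)).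
- by rewrite /= mxE lexx ltW.
- by rewrite /= mxE lexx ltW.
- by rewrite divr_gt0 ?subr_gt0 //= ltr_pdivrMr ?subr_gt0 // mul1r ltrD2r.
- by apply/rowP => i; rewrite (ord1 i) !mxE; field.
by rewrite mxE => ax0; move: ax; rewrite -ax0 ltxx.
Qed.

(** Full dimension provides enough vertices to complete [u] to an [m]-element set [U]. By (a) the
    projection of [conv U] is a full-dimensional simplex, so the projections of the [u i] are
    distinct vertices of a lattice-face polytope and induction applies. At the top value of [k] the
    set [U] is [u] itself, and (b) gives the integral equation. *)
Theorem latticeFace_flag m (P : set 'rV[R]_m) : latticeFace P ->
  forall k (u : 'I_k.+1 -> 'rV[R]_m), (k < m)%N -> injective u -> (forall i, vertex P (u i)) ->
  homog_mx (fun i => homog (u i)) \in unitmx /\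
  exists c : nat -> int, forall i,
    homog (u i) k.+1 = \sum_(j < k.+1) (c j)%:~R * homog (u i) j.
Proof.
elim: m P => [|[|m] IH] P LP k u //.
  case: k u => // u _ inj_u vu; split.
    by rewrite unitmxE det_mx11 mxE /= unitr1.
  move: LP vu => [a [b [[za Ea] [zb Eb] ltab ->]]] vu.
  have [u0|u0] := interval_vertex ltab (vu 0).
    exists (fun=> za) => i; rewrite (ord1 i) (homogS _ (0 : 'I_1)) u0 big_ord1 mulr1; exact: Ea.
  exists (fun=> zb) => i; rewrite (ord1 i) (homogS _ (0 : 'I_1)) u0 big_ord1 mulr1; exact: Eb.
move=> ltk inj_u vu; have [polyP fullP HU] := LP.
have [V [uV PV vV]] := polytope_vertices polyP.
have sizeV : (m.+3 <= size V)%N.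
  have fullV : fulldim (conv [set` V]) by rewrite -PV.
  by have := spanning_card (fulldim_spanning erefl fullV); rewrite cardsT card_ord.
pose W := [seq x <- V | x \notin codom u].
have uW : uniq W by rewrite filter_uniq.
have sizeW : (m.+3 - k.+1 <= size W)%N.
  have c1 := count_predC (mem (codom u)) V.
  have c2 : (count (mem (codom u)) V <= k.+1)%N.
    rewrite -size_filter -[X in (_ <= X)%N]card_ord -(size_codom u).
    by apply: uniq_leq_size; rewrite ?filter_uniq // => x; rewrite mem_filter => /andP[].
  have -> : size W = count (predC (mem (codom u))) V by rewrite size_filter.
  by rewrite leq_subLR (leq_trans sizeV) // -c1 leq_add2r.
pose U := codom u ++ take (m.+2 - k.+1) W.
have sU : size U = m.+2.
  rewrite size_cat size_codom card_ord size_take_min.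
  by rewrite (minn_idPl _) ?subnKC // (leq_trans _ sizeW) // leq_sub2r.
have uU : uniq U.
  rewrite cat_uniq map_inj_uniq // enum_uniq take_uniq // andbT /=.
  by apply/hasPn => x /mem_take; rewrite mem_filter => /andP[].
have vU x : x \in U -> vertex P x.
  rewrite mem_cat => /orP[/codomP[i ->] //|/mem_take].
  by rewrite mem_filter => /andP[_ /vV].
have [LP' ZP'] := HU U uU sU vU.
have nthU (i : 'I_k.+1) : U`_i = u i.
  by rewrite nth_cat size_codom card_ord ltn_ord codomE (nth_map i) ?size_enum_ord // nth_ord_enum.
have sp : size [seq proj x | x <- U] = m.+2 by rewrite size_map.
rewrite proj_conv in LP'.
have unitU := simplex_unit sp (latticeFace_fulldim LP').
have lek : (k.+1 <= m.+2)%N by [].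
have nthU' (i : 'I_k.+1) : [seq proj x | x <- U]`_i = proj (u i).
  by rewrite (nth_map 0) ?nthU // sU (leq_trans (ltn_ord i)).
have [ltk'|ek] : (k < m.+1)%N \/ k = m.+1 by lia.
  have inj_pu : injective (fun i => proj (u i)).
    move=> i j pij; apply/eqP.
    pose w l := widen_ord lek l.
    have := @unit_rows_inj _ _ unitU (fun l => (l == w i)%:R) (fun l => (l == w j)%:R).
    have sumE (l : 'I_m.+2) q : \sum_i0 (i0 == l)%:R * homog_family (n :=
        m.+2) [seq proj x | x <- U] i0 q =
        homog_family (n := m.+2) [seq proj x | x <- U] l q.
      by rewrite (bigD1 l) //= eqxx mul1r big1 ?addr0 // => i0 /negPf ->; rewrite mul0r.
    move=> /(_ _ (w i)) /=; rewrite eqxx => H.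
    have : (1 : R) = (w i == w j)%:R by apply: H => q _; rewrite !sumE /homog_family /= !nthU' pij.
    by case: eqP => [/(congr1 val) /= ij _|_ /eqP]; [exact/eqP/val_inj | rewrite oner_eq0].
  have vpu i : vertex (conv [set` [seq proj x | x <- U]]) (proj (u i)).
    by rewrite -nthU'; apply: (simplex_vertex (widen_ord lek i) sp unitU).
  have [un [c cE]] := IH _ LP' k _ ltk' inj_pu vpu.
  split.
    rewrite (_ : homog_mx _ = homog_mx (fun i => homog (proj (u i)))) //.
    by apply/matrixP => i j; rewrite !mxE homog_proj // (leq_trans (ltnW (ltn_ord j))).
  exists c => i; rewrite -homog_proj // cE; apply: eq_bigr => j _.
  by rewrite homog_proj // (leq_trans (ltnW (ltn_ord j))).
subst k.
have un : homog_mx (fun i => homog (u i)) \in unitmx.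
  rewrite (_ : homog_mx _ = homog_mx (homog_family (n := m.+2) [seq proj x | x <- U])) //.
  by apply/matrixP => i j; rewrite !mxE /homog_family nthU' homog_proj // -ltnS.
split => //; apply: integral_hyperplane => //.
by move: ZP'; rewrite /U subnn take0 cats0.
Qed.

End LatticeFaces.

(** * Volume and grid cells *)

Section Volume.
Variable R : realType.

Lemma vol_ge0 k (S : set 'rV[R]_k) : (0 <= vol S)%E.
Proof.
elim: k S => [|k IH] S /=; first by case: asboolP.
by apply: integral_ge0 => t _; apply: IH.
Qed.

(** The integral of a nonnegative function is a supremum over simple functions below it, hence
    monotone with no measurability of the slices. *)
Lemma le_vol k (S S' : set 'rV[R]_k) : S `<=` S' -> (vol S <= vol S')%E.
Proof.
elim: k S S' => [|k IH] S S' SS' /=.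
  case: asboolP => [[x Sx]|_]; last by case: asboolP.
  by case: asboolP => // -[]; exists x; apply: SS'.
rewrite !ge0_integralTE; try by move=> t; apply: vol_ge0.
apply: le_ereal_sup => _ [h /= hle <-]; exists h => //= t.
by apply: le_trans (hle t) _; apply: IH => y; apply: SS'.
Qed.

(** The grid consists of cubes of side [1 / N], open below and closed above, named by their upper
    corner scaled by [N]. *)
Definition cell (N : nat) k (x : 'rV[R]_k) : 'rV[int]_k := \row_i Num.ceil (N%:R * x 0 i).

Lemma ceil_eq_itv (N : nat) (c : int) (t : R) : (0 < N)%N ->
  (Num.ceil (N%:R * t) == c) = (t \in `](c - 1)%:~R / N%:R, c%:~R / N%:R]).
Proof.
move=> N0; have N0' : 0 < N%:R :> R by rewrite ltr0n.
by rewrite ceil_eq in_itv /= ltr_pdivrMr // ler_pdivlMr // (mulrC t).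
Qed.

Lemma vol_cells (N : nat) k (A : seq 'rV[int]_k) : (0 < N)%N -> uniq A ->
  vol [set x : 'rV[R]_k | cell N x \in A] = ((size A)%:R / N%:R ^+ k)%:E.
Proof.
move=> N0; have N0' : 0 < N%:R :> R by rewrite ltr0n.
elim: k A => [|k IH] A uA.
  rewrite /vol expr0 divr1; case: A uA => [_|z [|z' A]].
  - by case: asboolP => // -[].
  - by move=> _; case: asboolP => // -[]; exists 0; rewrite /= inE (thinmx0 z) thinmx0.
  - by rewrite (thinmx0 z) (thinmx0 z') /= inE eqxx.
pose pr (z : 'rV[int]_k.+1) : 'rV[int]_k := \row_i z 0 (widen_ord (leqnSn k) i).
pose A_ (c : int) := [seq pr z | z : 'rV[int]_k.+1 <- A & z 0 ord_max == c].
have pr_inj (z z' : 'rV[int]_k.+1) : z 0 ord_max = z' 0 ord_max -> pr z = pr z' -> z = z'.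
  move=> zl /rowP zp; apply/rowP => i; case: (unliftP ord_max i) => [j ->|->] //.
  have := zp j; rewrite !mxE; rewrite (_ : widen_ord _ _ = lift ord_max j) //.
  by apply: val_inj; rewrite /= /bump leqNgt ltn_ord.
have uA_ c : uniq (A_ c).
  rewrite map_inj_in_uniq ?filter_uniq // => z z'; rewrite !mem_filter.
  by move=> /andP[/eqP zc _] /andP[/eqP z'c _]; apply: pr_inj; rewrite zc z'c.
have pr_cell y t : pr (cell N (ext y t)) = cell N y :> 'rV[int]_k.
  apply/rowP => i; rewrite !mxE; case: unliftP => [j E|/(congr1 val) /= E].
    congr (Num.ceil (_ * y 0 _)); apply: val_inj; move/(congr1 val): E => /=.
    by rewrite /bump leqNgt ltn_ord.
  by have := ltn_ord i; rewrite E ltnn.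
have last_cell y t : (cell N (ext y t) : 'rV[int]_k.+1) 0 ord_max = Num.ceil (N%:R * t).
  by rewrite !mxE unlift_none.
(* Slicing at [t] keeps the cells whose last index is the ceiling of [N t], so the slice volume is a
   step function of [t]. *)
have slice t : vol [set y : 'rV[R]_k | cell N (ext y t) \in A] =
    (\sum_(z <- A) ((N%:R ^+ k)^-1 *
      \1_(`](z 0 ord_max - 1)%:~R / N%:R, (z 0 ord_max)%:~R / N%:R]) t)%:E)%E.
  have -> : [set y : 'rV[R]_k | cell N (ext y t) \in A] =
      [set y | cell N y \in A_ (Num.ceil (N%:R * t))].
    apply/seteqP; split => y /=.
      move=> yA; apply/mapP; exists (cell N (ext y t)); last by rewrite pr_cell.
      by rewrite mem_filter last_cell eqxx.
    move=> /mapP[z]; rewrite mem_filter => /andP[/eqP zl zA] E.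
    suff -> : cell N (ext y t) = z by [].
    by apply: pr_inj; [rewrite last_cell zl | rewrite pr_cell E].
  rewrite IH // size_map size_filter sumEFin; congr (_%:E).
  rewrite -sum1_count natr_sum mulr_suml big_mkcond; apply: eq_bigr => z _.
  rewrite indicE; have := ceil_eq_itv (z 0 ord_max) t N0; rewrite eq_sym => E.
  rewrite (_ : (t \in _) = (z 0 ord_max == Num.ceil (N%:R * t))); last first.
    by rewrite E mem_setE.
  by case: eqP => _; rewrite ?mul1r ?mulr1 ?mulr0.
transitivity (\int[@lebesgue_measure R]_t vol [set y : 'rV[R]_k | cell N (ext y t) \in A])%E => //.
under eq_integral do rewrite slice.
rewrite ge0_integral_sum //; last first.
  by move=> z; apply/measurable_EFinP; apply: measurable_funM.
have E z : (\int[@lebesgue_measure R]_t ((N%:R ^+ k)^-1 *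
    \1_(`](z 0 (@ord_max k) - 1 : int)%:~R / N%:R, (z 0 ord_max)%:~R / N%:R]) t)%:E)%E =
    ((N%:R ^+ k.+1)^-1)%:E.
  under eq_integral do rewrite EFinM.
  rewrite ge0_integralZl_EFin //; last by apply/measurable_EFinP.
  rewrite integral_indic // setIT /= lebesgue_measure_itv /= lte_fin.
  rewrite ltr_pM2r ?invr_gt0 // ltr_int ltrBlDr ltrDl ltr01 -EFinD -EFinM; congr (_%:E).
  rewrite exprS rmorphB /=; field; rewrite expf_neq0 ?gt_eqF //.
under eq_bigr do rewrite E.
rewrite sumEFin; congr (_%:E).
by rewrite big_const_seq count_predT iter_addr_0 -[LHS]mulr_natl.
Qed.

End Volume.

(** * Counting in lattice-face polytopes *)

Section Cones.
Variables (R : realType) (d n : nat) (v : 'I_n -> nat -> R).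
Local Notation incone := (incone d v).

Lemma eq_incone y y' : (forall j, (j <= d)%N -> y j = y' j) -> incone y -> incone y'.
Proof. by move=> yy' [mu mu0 [o E]]; exists mu => //; split => // j lej; rewrite -yy' ?E. Qed.

Lemma inconeD y y' : incone y -> incone y' -> incone (fun j => y j + y' j).
Proof.
move=> [mu mu0 [_ E]] [mu' mu'0 [_ E']].
exists (fun i => mu i + mu' i); first by move=> i; rewrite addr_ge0.
split=> [i|j lej]; first by rewrite inE.
by rewrite E // E' // -big_split /=; apply: eq_bigr => i _; rewrite mulrDl.
Qed.

Lemma inconeZ c y : 0 <= c -> incone y -> incone (fun j => c * y j).
Proof.
move=> c0 [mu mu0 [_ E]].
exists (fun i => c * mu i); first by move=> i; rewrite mulr_ge0.
split=> [i|j lej]; first by rewrite inE.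
by rewrite E // mulr_sumr; apply: eq_bigr => i _; rewrite mulrA.
Qed.

(** The sum of all vertices is interior to the cone. Multiplied by a [q] above the total size of the
    coefficients representing the unit vectors, it absorbs every perturbation of entries at most
    [1]. *)
Lemma incone_ball : spanning d v [set: 'I_n]%SET ->
  exists2 q : nat, (0 < q)%N & forall de : nat -> R,
    (forall j, (j <= d)%N -> `|de j| <= 1) -> incone (fun j => q%:R * (\sum_i v i j) + de j).
Proof.
move=> sp.
have /choice[nu nuP] (l : 'I_d.+1) := sp (fun j => ((l : nat) == j)%:R).
pose b := \sum_l \sum_i `|nu l i|.
have b0 : 0 <= b by apply: sumr_ge0 => l _; apply: sumr_ge0.
have bq : b <= (Num.bound b).+1%:R.
  by apply: le_trans (ltW (archi_boundP b0)) _; rewrite ler_nat.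
exists (Num.bound b).+1 => // de de1.
exists (fun i => (Num.bound b).+1%:R + \sum_l de (l : 'I_d.+1) * nu l i) => [i|].
  rewrite addrC -lerBlDr sub0r lerNl; apply: le_trans bq.
  rewrite (le_trans (ler_norm _)) // normrN (le_trans (ler_norm_sum _ _ _)) //.
  apply: ler_sum => l _; rewrite normrM (bigD1 i) //= -[leLHS]addr0 lerD ?sumr_ge0 //.
  by rewrite ler_piMl // de1 // -ltnS.
split=> [i|j lej]; first by rewrite inE.
under [RHS]eq_bigr do rewrite mulrDl mulr_suml.
rewrite big_split /= -mulr_sumr; congr (_ + _).
rewrite exchange_big /=; under eq_bigr do under eq_bigr do rewrite -mulrA.
under eq_bigr do rewrite -mulr_sumr -(nuP _).2 //.
rewrite (bigD1 (Ordinal (lej : (j < d.+1)%N))) //= eqxx mulr1 big1 ?addr0 // => l.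
by rewrite -val_eqE /= => /negPf ->; rewrite mulr0.
Qed.

End Cones.

Lemma bernoulli_ineq (R : realFieldType) (x : R) D : 0 <= x <= 1 -> 1 - D%:R * x <= (1 - x) ^+ D.
Proof.
move=> /andP[x0 x1]; elim: D => [|D IH]; first by rewrite mul0r subr0 expr0.
rewrite exprS; apply: le_trans (ler_wpM2l _ IH); last by rewrite subr_ge0.
have : 0 <= D%:R * x * x by rewrite !mulr_ge0.
by rewrite -natr1 => ?; nra.
Qed.

Lemma le_of_approx (R : archiRealFieldType) (a b : R) D : 0 <= a ->
  (forall M : nat, (1 < M)%N -> a * (1 - M%:R^-1) ^+ D <= b) -> a <= b.
Proof.
move=> a0 H; rewrite leNgt; apply/negP => ltba.
pose t := a * D%:R / (a - b); have d0 : 0 < a - b by rewrite subr_gt0.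
have t0 : 0 <= t by rewrite divr_ge0 ?mulr_ge0 // ltW.
pose M := (Num.bound t).+2.
have M0 : 0 < M%:R :> R by rewrite ltr0n.
have tM : t < M%:R by rewrite (lt_trans (archi_boundP t0)) // ltr_nat /M; lia.
have M1 : (0 <= M%:R^-1 :> R) && (M%:R^-1 <= 1 :> R).
  by rewrite invr_ge0 ltW //= invf_le1 // ler1n.
have := H M isT; apply/negP; rewrite -ltNge.
apply: lt_le_trans (ler_wpM2l a0 (bernoulli_ineq D M1)).
have : a * (D%:R * M%:R^-1) < a - b.
  by rewrite mulrA ltr_pdivrMr // [ltRHS]mulrC -ltr_pdivrMr.
by rewrite mulrBr mulr1; lra.
Qed.

Section LatticePolytope.
Variables (R : realType) (d : nat) (P : set 'rV[R]_d.+1).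

Definition row_of (z : seq int) : 'rV[int]_d.+1 := \row_i z`_i.

Definition point_of (z : seq int) : 'rV[R]_d.+1 := \row_i (z`_i)%:~R.

Lemma row_of_inj : {in [pred z | size z == d.+1] &, injective row_of}.
Proof.
move=> z z' /eqP sz /eqP sz' /rowP E; apply: (@eq_from_nth _ 0); first by rewrite sz.
by move=> i; rewrite sz => lti; have := E (Ordinal lti); rewrite !mxE.
Qed.

Variables (V : seq 'rV[R]_d.+1).
Hypothesis PV : P = conv [set` V].
Local Notation n := (size V).
Local Notation v := (homog_family (n := n) V).
Hypothesis fv : flag_integral d.+1 v.
Hypothesis sp : spanning d.+1 v [set: 'I_n]%SET.

Lemma homog_family0 i : v i 0%N = 1. Proof. by []. Qed.

Lemma mem_incone x : P x <-> incone d.+1 v (homog x).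
Proof. by rewrite PV; apply: conv_incone. Qed.

Lemma polytope_bounded : exists B : nat, forall x, P x -> forall i, `|x 0 i| <= B%:R.
Proof.
pose b := \sum_(l < n) \sum_i `|V`_l 0 i|.
have b0 : 0 <= b by apply: sumr_ge0 => l _; apply: sumr_ge0.
exists (Num.bound b) => x; rewrite PV => /(convP _ erefl)[mu [mu0 mu1 ->]] i.
rewrite summxE (le_trans _ (ltW (archi_boundP b0))) // (le_trans (ler_norm_sum _ _ _)) //.
apply: ler_sum => l _; rewrite mxE normrM (bigD1 i) //= -[leLHS]addr0 lerD ?sumr_ge0 //.
rewrite ler_piMl // ger0_norm // -mu1 (bigD1 l) //= lerDl.
by apply: sumr_ge0.
Qed.

Lemma mem_Omega z : size z = d.+1 -> Lat (Omega P) (point_of z) <->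
  incone d.+1 v (low_point 2^-1 d.+1 1%:~R (fun=> 0) z).
Proof.
move=> sz.
have h01 : (0 < 2^-1 :> R) && (2^-1 < 1 :> R) by apply/andP; split; lra.
have homogE j : (j <= d.+1)%N -> homog (point_of z) j = low_point 0 d.+1 1%:~R (fun=> 0) z j :> R.
  case: j => [|j] // ltj; rewrite (homogS _ (Ordinal ltj)) mxE /low_point /last_shift.
  by rewrite !subr0; case: ifP => _; rewrite subr0.
split=> [[[Pz nNB] _]|inc].
  have [x' [Px' [px' lx']]] : exists x', P x' /\ proj x' = proj (point_of z) /\
      lastc x' < lastc (point_of z).
    apply: contrapT => nx; apply: nNB; split => // x' Px' px'; rewrite leNgt; apply/negP => lx'.
    by apply: nx; exists x'.
  (* Mixing [x'] into [z] with weight [th] lowers [z] by [s0 / (1 + s0)], which is strictly between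
     [0] and [1] however far below [x'] lies; [low_point_line] then moves the shift to one half. *)
  pose s0 := lastc (point_of z) - lastc x'; have s0_gt0 : 0 < s0 by rewrite subr_gt0.
  pose th := (1 + s0)^-1; have d0 : 0 < 1 + s0 by rewrite addr_gt0.
  have th_gt0 : 0 < th by rewrite invr_gt0.
  have th1 : th <= 1 by rewrite invf_le1 // lerDl ltW.
  have s01 : 0 < th * s0 < 1 by rewrite mulr_gt0 //= mulrC ltr_pdivrMr // mul1r ltrDr.
  apply: (low_point_line homog_family0 fv sp s01); first by lra.
  have th0' : 0 <= 1 - th by rewrite subr_ge0.
  have := inconeD (inconeZ th0' ((mem_incone _).1 Pz)) (inconeZ (ltW th_gt0) ((mem_incone _).1
      Px')).
  apply: eq_incone => j lej.
  have lastE (x : 'rV[R]_d.+1) : homog x d.+1 = lastc x by rewrite (homogS x ord_max).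
  have [->|nj] := eqVneq j d.+1.
    rewrite !lastE /low_point /last_shift eqxx /s0.
    have -> : (z`_d - 0)%:~R = lastc (point_of z) by rewrite /lastc mxE subr0.
    by ring.
  have lej' : (j <= d)%N by move: lej; rewrite leq_eqVlt (negPf nj).
  rewrite -(homog_proj x') // px' homog_proj // homogE // /low_point /last_shift.
  by case: j nj {lej lej'} => [|j] nj; rewrite ?(negPf nj); ring.
have Pz : P (point_of z).
  apply/mem_incone; have := low_point_line homog_family0 fv sp h01 (_ : 0 <= 0 <= 1) inc.
  rewrite lexx ler01 => /(_ isT); apply: eq_incone => j lej.
  by rewrite homogE.
split; last by move=> i; exists z`_i; rewrite mxE.
split=> // -[_ low].
(* Sliding on to the shift [1] gives a point of [P] directly below [z], so [z] is not on the
   negative boundary. *)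
pose x' : 'rV[R]_d.+1 := \row_i ((z`_i)%:~R - (if i == ord_max then 1 else 0)).
have Px' : P x'.
  apply/mem_incone; have := low_point_line homog_family0 fv sp h01 (_ : 0 <= 1 <= 1) inc.
  rewrite ler01 lexx => /(_ isT); apply: eq_incone => -[|j] // ltj.
  rewrite (homogS x' (Ordinal ltj)) mxE /low_point /last_shift subr0 eqSS.
  by rewrite -val_eqE.
have := low _ Px'; rewrite /lastc !mxE eqxx.
suff -> : proj x' = proj (point_of z) by move=> /(_ erefl); lra.
by apply/rowP => i; rewrite !mxE -val_eqE /= ltn_eqF // subr0.
Qed.

Definition cone_points (s : R) (N : int) (c : nat -> int) (B : nat) : seq (seq int) :=
  [seq z <- box B d.+1 | `[< incone d.+1 v (low_point s d.+1 N%:~R c z) >]].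

Lemma size_filter_sum (T : eqType) (p : pred T) (r : seq T) :
  (size [seq z <- r | p z])%:R = \sum_(z <- r) (p z)%:R :> R.
Proof.
rewrite size_filter -sum1_count natr_sum big_mkcond.
by apply: eq_bigr => z _; case: (p z).
Qed.

Lemma flag_integral_card : (d.+1 <= n)%N.
Proof. by have := spanning_card sp; rewrite cardsT card_ord => /ltnW. Qed.

Lemma barycenter_int : exists C : nat -> int, forall j, (j <= d.+1)%N ->
  \sum_i v i j = (C j)%:~R.
Proof.
exists (fun j => Num.floor (\sum_i v i j)) => j lej; rewrite floorK //.
by apply: rpred_sum => i _; apply: flag_integral_int fv flag_integral_card lej.
Qed.

Lemma mem_incone_scaled (N : nat) (x : 'rV[R]_d.+1) : (0 < N)%N ->
  P x <-> incone d.+1 v (fun j => N%:R * homog x j).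
Proof.
move=> N0; have N0' : 0 < N%:R :> R by rewrite ltr0n.
split=> [/mem_incone /(inconeZ (ltW N0')) //|inc]; apply/mem_incone.
have := inconeZ (_ : 0 <= N%:R^-1) inc; rewrite invr_ge0 ltW // => /(_ isT).
by apply: eq_incone => j _; rewrite mulrA mulVf ?mul1r // gt_eqF.
Qed.

(* [P] is squeezed between the unions of the cells of two lattice point sets of dilations of [P]
   about its barycenter, by [(M - 1) / M] and [(M + 1) / M]. *)
Lemma vol_squeeze (K : R) :
  (forall (N : int) c, 0 < N ->
    evsum d.+1 (fun z => `[< incone d.+1 v (low_point 2^-1 d.+1 N%:~R c z) >]%:R)
      (N%:~R ^+ d.+1 * K)) ->
  forall M : nat, (1 < M)%N ->
  ((K * (1 - M%:R^-1) ^+ d.+1)%:E <= vol P)%E /\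
  (vol P <= (K * (1 + M%:R^-1) ^+ d.+1)%:E)%E.
Proof.
move=> HK M M1.
have [q q0 ball] := incone_ball sp; have [C CE] := barycenter_int.
have n0 : (0 < n)%N by apply: leq_trans flag_integral_card.
(* [J] is the weight of [q] times the sum of the vertices. With mesh [1 / (M J)], adding or removing
   that vector changes the dilation factor [M J] to [(M + 1) J] or [(M - 1) J]; the lattice vector
   [c] is its position. *)
pose J := (q * n)%N; have J0 : (0 < J)%N by rewrite muln_gt0 q0.
pose c j : int := q%:Z * C j.+1.
pose N := (M * J)%N; have N0 : (0 < N)%N by rewrite muln_gt0 J0 (ltn_trans _ M1).
have ball' (de : nat -> R) : de 0%N = 0 -> (forall j, (j <= d.+1)%N -> `|de j| <= 1) ->
    incone d.+1 v (fun j => if j is j'.+1 then (c j')%:~R + de j else J%:R).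
  move=> de0 de1; apply: eq_incone (ball de de1) => -[|j] lej.
    by rewrite de0 addr0 /homog_family /= sumr_const card_ord /J natrM.
  by rewrite CE // /c rmorphM.
have cellE (x : 'rV[R]_d.+1) j (ltj : (j < d.+1)%N) :
    exists2 eta, 0 <= eta < 1 & N%:R * homog x j.+1 = (cell N x 0 (Ordinal ltj))%:~R - eta.
  exists ((cell N x 0 (Ordinal ltj))%:~R - N%:R * homog x j.+1); last by ring.
  rewrite (homogS x (Ordinal ltj)) mxE.
  have /andP[] := ceil_itv (N%:R * x 0 (Ordinal ltj)); rewrite rmorphB /= => h1 h2.
  by apply/andP; split; lra.
(* Rounding up to a cell corner and lowering by one half together move each coordinate by at most
   one, which [ball'] absorbs. *)
have bound_half (eta : R) j : 0 <= eta < 1 -> `|last_shift 2^-1 d.+1 j - eta| <= 1.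
  by rewrite ler_norml /last_shift => /andP[? ?]; case: ifP => _; apply/andP; split; lra.
have [B0 PB] := polytope_bounded.
split.
- have [|B HB] := HK ((M.-1 * J)%:Z) c; first by rewrite ltz_nat muln_gt0 J0 andbT; lia.
  have {HB} := HB _ (leqnn _); rewrite -size_filter_sum -/(cone_points _ _ _ _).
  set A := cone_points _ _ _ _ => sA.
  have uA : uniq [seq row_of z | z <- A].
    rewrite map_inj_in_uniq ?filter_uniq ?box_uniq // => z z' zA z'A.
    by apply: row_of_inj; [move: zA | move: z'A]; rewrite mem_filter mem_box inE => /and3P[].
  have <- : vol [set x : 'rV[R]_d.+1 | cell N x \in [seq row_of z | z <- A]] =
      (K * (1 - M%:R^-1) ^+ d.+1)%:E.
    rewrite vol_cells // size_map sA; congr (_%:E).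
    rewrite mulrAC [RHS]mulrC -expr_div_n; congr (_ ^+ _ * _).
    have -> : ((M.-1 * J)%:Z)%:~R = (M%:R - 1) * J%:R :> R.
      by rewrite -[LHS]/((M.-1 * J)%:R) natrM -subn1 natrB // ltnW.
    by rewrite /N natrM; field; rewrite !pnatr_eq0 -!lt0n J0 (ltn_trans _ M1).
  apply: le_vol => x /= /mapP[z]; rewrite mem_filter => /andP[/asboolP inc zB] xz.
  apply/(mem_incone_scaled _ N0).
  pose de j := if j is j'.+1 then N%:R * homog x j - (z`_j')%:~R + last_shift 2^-1 d.+1 j else 0
      : R.
  have := inconeD inc (ball' de erefl _).
  have zE j (ltj : (j < d.+1)%N) : z`_j = cell N x 0 (Ordinal ltj) by rewrite xz mxE.
  move=> H; apply: eq_incone (H _) => [[|j] ltj|[|j] ltj]; last 2 first.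
  - by rewrite normr0.
  - have [eta eta01 E] := cellE x j ltj.
    rewrite /de E zE (_ : _ + _ = last_shift 2^-1 d.+1 j.+1 - eta); first exact: bound_half.
    by ring.
  - rewrite /low_point /= mulr1 -[((M.-1 * J)%:Z)%:~R]/((M.-1 * J)%:R) -natrD /N.
    by congr (_%:R); rewrite -mulSnr prednK // ltnW.
  - by rewrite /low_point /de rmorphB /=; ring.
- pose c' j := - c j.
  have [|B1 HB] := HK ((M.+1 * J)%:Z) c'; first by rewrite ltz_nat muln_gt0 J0.
  (* The box must also contain every cell that meets [P]. *)
  pose B := maxn B1 (N * B0).+2.
  have {HB} := HB B (leq_maxl _ _); rewrite -size_filter_sum -/(cone_points _ _ _ _).
  set A := cone_points _ _ _ _ => sA.
  have uA : uniq [seq row_of z | z <- A].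
    rewrite map_inj_in_uniq ?filter_uniq ?box_uniq // => z z' zA z'A.
    by apply: row_of_inj; [move: zA | move: z'A]; rewrite mem_filter mem_box inE => /and3P[].
  have <- : vol [set x : 'rV[R]_d.+1 | cell N x \in [seq row_of z | z <- A]] =
      (K * (1 + M%:R^-1) ^+ d.+1)%:E.
    rewrite vol_cells // size_map sA; congr (_%:E).
    rewrite mulrAC [RHS]mulrC -expr_div_n; congr (_ ^+ _ * _).
    rewrite -[((M.+1 * J)%:Z)%:~R]/((M.+1 * J)%:R) natrM -[M.+1%:R]natr1.
    by rewrite /N natrM; field; rewrite !pnatr_eq0 -!lt0n J0 (ltn_trans _ M1).
  apply: le_vol => x Px /=; apply/mapP.
  pose z : seq int := [seq cell N x 0 i | i <- enum 'I_d.+1].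
  have zE j (ltj : (j < d.+1)%N) : z`_j = cell N x 0 (Ordinal ltj).
    rewrite (nth_map ord0) ?size_enum_ord //; congr (cell N x 0 _).
    by apply: val_inj; rewrite /= nth_enum_ord.
  exists z; last by apply/rowP => i; rewrite [RHS]mxE zE; congr (cell N x 0 _); apply: val_inj.
  rewrite mem_filter mem_box size_map size_enum_ord eqxx /=; apply/andP; split; last first.
    apply/allP => _ /mapP[i _ ->]; rewrite inE mem_irange mxE.
    have := PB x Px i; rewrite ler_norml => /andP[h1 h2].
    have N0' : 0 <= N%:R :> R by [].
    have lo : (- (N * B0)%:Z)%:~R <= N%:R * x 0 i.
      by rewrite rmorphN /= -[((N * B0)%:Z)%:~R]/((N * B0)%:R) natrM -mulrN ler_wpM2l.
    have hi : N%:R * x 0 i <= ((N * B0)%:Z)%:~R.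
      by rewrite -[((N * B0)%:Z)%:~R]/((N * B0)%:R) natrM ler_wpM2l.
    have hi' : Num.ceil (N%:R * x 0 i) <= (N * B0)%:Z by rewrite ceil_le_int.
    have lo' : - (N * B0)%:Z <= Num.ceil (N%:R * x 0 i).
      by rewrite -(ler_int R); apply: le_trans lo (ceil_ge _).
    have BN : ((N * B0).+2 <= B)%N by apply: leq_maxr.
    by lia.
  apply/asboolP; have /(mem_incone_scaled _ N0) inc := Px.
  pose de j := if j is j'.+1 then (z`_j')%:~R - N%:R * homog x j - last_shift 2^-1 d.+1 j else 0
      : R.
  have := inconeD inc (ball' de erefl _).
  move=> H; apply: eq_incone (H _) => [[|j] ltj|[|j] ltj]; last 2 first.
  - by rewrite normr0.
  - have [eta eta01 E] := cellE x j ltj; rewrite -normrN.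
    have -> : - de j.+1 = last_shift 2^-1 d.+1 j.+1 - eta by rewrite /de E zE; ring.
    exact: bound_half.
  - rewrite /low_point /= mulr1 -[((M.+1 * J)%:Z)%:~R]/((M.+1 * J)%:R) -natrD /N.
    by congr (_%:R); rewrite mulSnr.
  - by rewrite /low_point /de /c' rmorphB rmorphN /=; ring.
Qed.

End LatticePolytope.

Lemma eq_vol_of_squeeze (R : realType) (d : nat) (P : set 'rV[R]_d.+1) (K : R) :
  (forall M : nat, (1 < M)%N ->
  ((K * (1 - M%:R^-1) ^+ d.+1)%:E <= vol P)%E /\
  (vol P <= (K * (1 + M%:R^-1) ^+ d.+1)%:E)%E) -> 0 <= K -> vol P = K%:E.
Proof.
move=> H K0; have [h1 h2] := H 2%N isT.
have : vol P \is a fin_num.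
  by rewrite fin_numElt (lt_le_trans _ h1) ?ltNyr // (le_lt_trans h2) ?ltry.
move: (vol_ge0 P) H; case: (vol P) => // a a0 H _; rewrite lee_fin in a0.
congr (_%:E); apply/eqP; rewrite eq_le; apply/andP; split.
  apply: (@le_of_approx _ _ _ d.+1 a0) => M M1; have [_] := H M M1; rewrite lee_fin => h.
  have M0 : 0 < M%:R :> R by rewrite ltr0n ltnW.
  have M1' : M%:R^-1 <= 1 :> R by rewrite invf_le1 // ler1n ltnW.
  (* Since [(1 + 1/M) * (1 - 1/M) <= 1], the upper bound on the volume becomes a lower bound on [K],
     and [le_of_approx] serves both directions. *)
  apply: le_trans (ler_wpM2r _ h) _; first by rewrite exprn_ge0 // subr_ge0.
  rewrite -mulrA -exprMn -[leRHS]mulr1 ler_wpM2l // exprn_ile1 //.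
    by rewrite mulr_ge0 ?subr_ge0 // addr_ge0 // invr_ge0 ltW.
  have -> : (1 + M%:R^-1) * (1 - M%:R^-1) = 1 - M%:R^-1 ^+ 2 :> R by ring.
  by rewrite gerBl sqr_ge0.
by apply: (@le_of_approx _ _ _ d.+1 K0) => M M1; have [] := H M M1; rewrite lee_fin.
Qed.

Unset Implicit Arguments. Set Strict Implicit. Set Printing Implicit Defensive.

Theorem mainTheorem2 (R : realType) (d : nat) (P : set 'rV[R]_d.+1) :
  latticeFace P ->
  exists2 s : seq 'rV[R]_d.+1, uniq s &
    [set` s] = Lat (Omega P) /\ vol P = ((size s)%:R)%:E.
Proof.
move=> LP; have [V [uV PV vV]] := polytope_vertices (latticeFace_polytope LP).
pose v := homog_family (n := size V) V.
have fv : flag_integral d.+1 v.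
  move=> k ltk u inj_u; apply: (latticeFace_flag LP (u := fun i => V`_(u i))) => //.
    by move=> i j /eqP; rewrite nth_uniq // => /eqP /val_inj /inj_u.
  by move=> i; apply/vV/mem_nth.
have sp : spanning d.+1 v [set: 'I_(size V)]%SET.
  by apply: fulldim_spanning => //; rewrite -PV; apply: latticeFace_fulldim.
have h01 : (0 < 2^-1 :> R) && (2^-1 < 1 :> R) by apply/andP; split; lra.
have [K HK] := count_lattice_polytope (@homog_family0 R d V) fv sp h01.
(* Without dilation the count is [K] itself; [vol_squeeze] identifies the same [K] with the
   volume. *)
have [B1 HB] := HK 1 (fun=> 0) isT.
have [B0 PB] := polytope_bounded PV.
pose B := maxn B1 B0.+1.
have {HB} := HB B (leq_maxl _ _); rewrite -size_filter_sum -/(cone_points V _ _ _ _).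
set A := cone_points _ _ _ _ _; rewrite expr1n mul1r => sA.
have sizeA z : z \in A -> size z = d.+1.
  by rewrite mem_filter mem_box => /and3P[_ /eqP].
exists [seq point_of R d z | z <- A].
  rewrite map_inj_in_uniq ?filter_uniq ?box_uniq // => z z' /sizeA sz /sizeA sz' /rowP E.
  apply: (@eq_from_nth _ 0); first by rewrite sz.
  by move=> i; rewrite sz => lti; have := E (Ordinal lti); rewrite !mxE => /intr_inj.
split; last first.
  rewrite size_map sA; apply: eq_vol_of_squeeze; last by rewrite -sA.
  by apply: vol_squeeze HK.
apply/seteqP; split => x /=.
  move=> /mapP[z zA ->]; have := zA; rewrite mem_filter => /andP[/asboolP inc _].
  by apply/(mem_Omega PV fv sp (sizeA _ zA)).
move=> Lx; have [[Px _] Zx] := Lx.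
pose z : seq int := [seq Num.floor (x 0 i) | i <- enum 'I_d.+1].
have sz : size z = d.+1 by rewrite size_map size_enum_ord.
have xE : x = point_of R d z.
  apply/rowP => i; rewrite mxE (nth_map ord0) ?size_enum_ord // nth_ord_enum floorK //.
  by have [m ->] := Zx i; apply: intr_int.
apply/mapP; exists z => //; rewrite mem_filter mem_box sz eqxx /=; apply/andP; split.
  by apply/asboolP/(mem_Omega PV fv sp sz); rewrite -xE.
apply/allP => _ /mapP[i _ ->]; rewrite inE mem_irange.
have BN : (B0.+1 <= B)%N by apply: leq_maxr.
have := PB x Px i; have [m ->] := Zx i; rewrite intrKfloor -intr_norm.
rewrite -[B0%:R]/((B0%:Z)%:~R) ler_int; lia.
Qed.
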